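(* Let $\mathcal{L} \subset \mathbb{P}^{2}_{\mathbb{R}}$ be a free arrangement of $d$ lines having only double, triple and quadruple intersection points. Then $d \leq 18$.
   Context: A line arrangement of $d$ lines is a finite set of $d$ distinct lines in the projective plane. An intersection point is $k$-fold (has multiplicity $k$) if exactly $k$ lines of the arrangement pass through it; ''only double, triple and quadruple intersection points'' means that every intersection point has multiplicity $2$, $3$ or $4$ (not all of these multiplicities need occur). Freeness: let $S=\mathbb{C}[x,y,z]$. A reduced curve $C=\{f=0\}\subset\mathbb{P}^2_{\mathbb{C}}$, with $f\in S$ homogeneous of degree $d$, is free if its Jacobian ideal $J_f=\langle \partial_x f,\partial_y f,\partial_z f\rangle$ is saturated with respect to $\mathfrak{m}=\langle x,y,z\rangle$. A line arrangement is regarded as the reduced curve defined by the product $f$ of the linear forms defining its lines. A real line arrangement in $\mathbb{P}^2_{\mathbb{R}}$ is called free if it is free when regarded as an arrangement in $\mathbb{P}^2_{\mathbb{C}}$ via the natural inclusion $\mathbb{R}\subset\mathbb{C}$ (same linear forms). *)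

(* Defs.v *)
From mathcomp Require Import all_boot all_order all_algebra.
From mathcomp Require Import reals complex.
From mathcomp Require Import mpoly.
Set Implicit Arguments.
Unset Strict Implicit.
Unset Printing Implicit Defensive.
Import GRing.Theory.
Local Open Scope ring_scope.

Definition gen_ideal (K : fieldType) (n : nat) (I : finType)
    (F : I -> {mpoly K[n]}) (g : {mpoly K[n]}) : Prop :=
  exists a : I -> {mpoly K[n]}, g = \sum_i a i * F i.

(* The k-th power of m = <X_0, ..., X_(n-1)>, generated by the k-fold products
   of the generators of m; for k = 0 it is the unit ideal. *)
Definition max_ideal_pow (K : fieldType) (n k : nat) :
    {mpoly K[n]} -> Prop :=
  gen_ideal (fun s : {ffun 'I_k -> 'I_n} => \prod_(j < k) 'X_(s j)).

(* J : m^oo is contained in J; the reverse inclusion holds for every ideal. *)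
Definition saturated (K : fieldType) (n : nat) (J : {mpoly K[n]} -> Prop) :
    Prop :=
  forall (g : {mpoly K[n]}) (k : nat),
    (forall h : {mpoly K[n]}, max_ideal_pow k h -> J (h * g)) -> J g.

Definition jacobian_ideal (K : fieldType) (n : nat) (f : {mpoly K[n]}) :
    {mpoly K[n]} -> Prop :=
  gen_ideal (fun i : 'I_n => f^`M(i)).

Definition free_curve (K : fieldType) (f : {mpoly K[3]}) : Prop :=
  saturated (jacobian_ideal f).

(* The row vector a = (a_0, a_1, a_2) <> 0 stands for the line
   a_0 x + a_1 y + a_2 z = 0 of P^2; two such vectors define the same line iff
   they span the same row space. The arrangement is the set of these lines, and
   the last condition says that the d lines are pairwise distinct. *)
Definition line_arrangement (K : fieldType) (d : nat) (A : 'I_d -> 'rV[K]_3) :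
    Prop :=
  (forall i, A i != 0) /\ (forall i j, (A i == A j)%MS -> i = j).

(* Points of P^2 are given by homogeneous coordinates p <> 0. *)
Definition on_line (K : fieldType) (p a : 'rV[K]_3) : bool :=
  \sum_(j < 3) a 0 j * p 0 j == 0.

Definition multiplicity (K : fieldType) (d : nat) (A : 'I_d -> 'rV[K]_3)
    (p : 'rV[K]_3) : nat :=
  #|[set i | on_line p (A i)]|.

Definition intersection_point (K : fieldType) (d : nat)
    (A : 'I_d -> 'rV[K]_3) (p : 'rV[K]_3) : Prop :=
  p != 0 /\ (2 <= multiplicity A p)%N.

Definition linear_form (K : fieldType) (a : 'rV[K]_3) : {mpoly K[3]} :=
  \sum_(j < 3) a 0 j *: 'X_j.

Definition defining_poly (K : fieldType) (d : nat) (A : 'I_d -> 'rV[K]_3) :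
    {mpoly K[3]} :=
  \prod_(i < d) linear_form (A i).

Definition complexify (R : realType) (d : nat) (A : 'I_d -> 'rV[R]_3) :
    'I_d -> 'rV[R[i]]_3 :=
  fun i => map_mx (real_complex R) (A i).

Definition free_real_arrangement (R : realType) (d : nat)
    (A : 'I_d -> 'rV[R]_3) : Prop :=
  free_curve (defining_poly (complexify A)).

(* Main.v *)
Require Import Defs.
From mathcomp Require Import all_boot all_order all_algebra.
From mathcomp Require Import reals.
From mathcomp Require Import complex mpoly ring lra zify boolp.
Set Implicit Arguments.
Unset Strict Implicit.
Unset Printing Implicit Defensive.
Import Order.TTheory GRing.Theory Num.Theory.

(** Let [e = d - 1], and let [t_k] be the number of [k]-fold points.

    Freeness is only used through a dimension count. Let [J] be the Jacobian ideal of
    [f], [X] the set of lines through an intersection point, [q] the product of the other lines.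
    A form [g] of degree [k] satisfying the [(|X| - 1)^2] local conditions at the point has
    [q^2 g] in [J]; if this holds at every point, then saturation gives [g] in [J].
    As [J] is generated by three forms of degree [e], its degree [k] part has dimension at most
    [3 C(k - e + 2, 2)], so [C(k + 2, 2) - 3 C(k - e + 2, 2) <= t_2 + 4 t_3 + 9 t_4], and
    choosing [k] close to [3 e / 2] yields [3 e^2 <= 4 (t_2 + 4 t_3 + 9 t_4)].

    Over the reals, Melchior's inequality [t_2 >= 3 + t_4] holds: the chambers in [R^3]
    (topes) are counted by deletion and restriction, and each has at least three walls.
    Together with [2 t_2 + 6 t_3 + 12 t_4 = e (e + 1)] this gives [(e - 2) (e - 18) <= 0].
    For [e = 18] all inequalities are equalities, so [t_2 = 27], [t_3 = 0], [t_4 = 24] and all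
    200 topes are triangular cones. Such a cone contains at most one double point, while every
    double point lies on 8 topes, contradicting [8 * 27 > 200]. *)

(** * Lines, points and flats *)

Section Dot.
Local Open Scope ring_scope.
Variable K : fieldType.
Implicit Types (a b c x y p : 'rV[K]_3).

Definition dot a x : K := \sum_(j < 3) a 0 j * x 0 j.

(** Indices are added modulo 3 in ['I_3]. The vector is the common point of two lines or the line
    through two points; [dot c (cross a b)] is the determinant of [a], [b], [c]. *)
Definition cross a b : 'rV[K]_3 :=
  \row_(j < 3) (a 0 (j + 1) * b 0 (j + 2) - a 0 (j + 2) * b 0 (j + 1)).

Lemma sum3 (V : zmodType) (F : 'I_3 -> V) : \sum_j F j = F 0 + F 1 + F 2.
Proof.
rewrite !big_ord_recl big_ord0 addr0 addrA.
by congr (F _ + F _ + F _); apply/val_inj.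
Qed.

Lemma row3P x y : x 0 0 = y 0 0 -> x 0 1 = y 0 1 -> x 0 2 = y 0 2 -> x = y.
Proof.
move=> h0 h1 h2; apply/rowP => -[[|[|[|//]]] hj].
- by rewrite (_ : Ordinal hj = 0) //; apply/val_inj.
- by rewrite (_ : Ordinal hj = 1) //; apply/val_inj.
- by rewrite (_ : Ordinal hj = 2) //; apply/val_inj.
Qed.

Lemma dotE a x : dot a x = a 0 0 * x 0 0 + a 0 1 * x 0 1 + a 0 2 * x 0 2.
Proof. exact: sum3. Qed.

Lemma crossE0 a b : cross a b 0 0 = a 0 1 * b 0 2 - a 0 2 * b 0 1.
Proof. by rewrite mxE !add0r. Qed.

Lemma crossE1 a b : cross a b 0 1 = a 0 2 * b 0 0 - a 0 0 * b 0 2.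
Proof. by rewrite mxE; congr (a 0 _ * b 0 _ - a 0 _ * b 0 _); apply/val_inj. Qed.

Lemma crossE2 a b : cross a b 0 2 = a 0 0 * b 0 1 - a 0 1 * b 0 0.
Proof. by rewrite mxE; congr (a 0 _ * b 0 _ - a 0 _ * b 0 _); apply/val_inj. Qed.

Definition crossE := (crossE0, crossE1, crossE2).

Lemma dotDr a x y : dot a (x + y) = dot a x + dot a y.
Proof. by rewrite !dotE !mxE; ring. Qed.

Lemma dotZr k a x : dot a (k *: x) = k * dot a x.
Proof. by rewrite !dotE !mxE; ring. Qed.

Lemma dotNr a x : dot a (- x) = - dot a x.
Proof. by rewrite !dotE !mxE; ring. Qed.

Lemma dot_crossl a b : dot a (cross a b) = 0.
Proof. by rewrite dotE !crossE; ring. Qed.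

Lemma dot_crossr a b : dot b (cross a b) = 0.
Proof. by rewrite dotE !crossE; ring. Qed.

Lemma dot_cross_rot a b c : dot a (cross b c) = dot b (cross c a).
Proof. by rewrite !dotE !crossE; ring. Qed.

Lemma dot_cross_swap a b c : dot a (cross b c) = - dot a (cross c b).
Proof. by rewrite !dotE !crossE; ring. Qed.

Lemma dot_cramer a b c x :
  dot c (cross a b) *: x =
  dot x (cross b c) *: a + dot x (cross c a) *: b + dot x (cross a b) *: c.
Proof. by apply/row3P; rewrite !mxE !dotE !crossE; ring. Qed.

Lemma dotC a x : dot a x = dot x a.
Proof. by rewrite !dotE; ring. Qed.

Lemma dot_neq0 a : a != 0 -> exists x, dot a x != 0.
Proof.
move=> a0; have [j aj] : exists j, a 0 j != 0.
  apply/existsP; apply: contraNT a0; rewrite negb_exists => /forallP h.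
  by apply/eqP/rowP => j; rewrite mxE; apply/eqP; have := h j; rewrite negbK.
exists (delta_mx 0 j); rewrite /dot (bigD1 j) //= big1 => [|i ij].
  by rewrite mxE !eqxx mulr1 addr0.
by rewrite mxE (negPf ij) andbF mulr0.
Qed.

Lemma cross_eq0 a b : a != 0 -> cross a b = 0 -> exists k, b = k *: a.
Proof.
move=> a0 e.
have [x ax] := dot_neq0 a0.
exists (dot b x / dot a x).
(* It suffices that [dot a x *: b = dot b x *: a], whose two sides differ by terms containing the
   coordinates of [cross a b]. *)
apply: (scalerI ax); rewrite scalerA mulrC divfK //.
have h i : cross a b 0 i = 0 by rewrite e mxE.
have h0 := h 0; have h1 := h 1; have h2 := h 2; rewrite !crossE in h0 h1 h2.
apply/eqP; rewrite -subr_eq0; apply/eqP; apply/row3P; rewrite !mxE !dotE.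
- rewrite [LHS](_ : _ = - (a 0 0 * b 0 1 - a 0 1 * b 0 0) * x 0 1
   + (a 0 2 * b 0 0 - a 0 0 * b 0 2) * x 0 2); first by rewrite h1 h2; ring.
  by ring.
- rewrite [LHS](_ : _ = (a 0 0 * b 0 1 - a 0 1 * b 0 0) * x 0 0
   - (a 0 1 * b 0 2 - a 0 2 * b 0 1) * x 0 2); first by rewrite h0 h2; ring.
  by ring.
- rewrite [LHS](_ : _ = (a 0 1 * b 0 2 - a 0 2 * b 0 1) * x 0 1
   - (a 0 2 * b 0 0 - a 0 0 * b 0 2) * x 0 0); first by rewrite h0 h1; ring.
  by ring.
Qed.

Lemma cross_cross a b x : cross (cross a b) x = dot a x *: b - dot b x *: a.
Proof. by apply/row3P; rewrite !crossE !mxE !dotE; ring. Qed.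

Lemma cross_span a b x : cross a b != 0 -> dot a x = 0 -> dot b x = 0 ->
  exists k, x = k *: cross a b.
Proof.
move=> ab ax bx; apply: cross_eq0 => //.
by rewrite cross_cross ax bx !scale0r subr0.
Qed.

Lemma dot_cross_eq0 a b c : cross a b != 0 -> dot c (cross a b) = 0 ->
  exists k l, c = k *: a + l *: b.
Proof.
move=> ab c0; have [x] := dot_neq0 ab; rewrite dotC => xab.
have := dot_cramer a b c x; rewrite c0 scale0r => /esym/eqP.
rewrite addr_eq0 => /eqP e.
exists (- (dot x (cross b c) / dot x (cross a b))).
exists (- (dot x (cross c a) / dot x (cross a b))).
apply: (scalerI xab); rewrite scalerDr !scalerA !mulrN !(mulrC (dot x (cross a b))).
by rewrite !divfK // !scaleNr -opprD e opprK.
Qed.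

End Dot.

Section Flats.
Local Open Scope ring_scope.
Variables (K : fieldType) (d : nat) (A : 'I_d -> 'rV[K]_3).
Implicit Types (i j k l : 'I_d) (X Y : {set 'I_d}).

Definition vertex i j := cross (A i) (A j).

(** An intersection point is encoded by the set of lines through it, so that the points form a
    finite set. For [i = j] the vertex is 0 and every line belongs to the set, hence the restriction
    to distinct lines in [flats]. *)
Definition flat i j : {set 'I_d} := [set k | dot (A k) (vertex i j) == 0].

Definition flats : {set {set 'I_d}} :=
  [set flat p.1 p.2 | p : 'I_d * 'I_d in [set p | p.1 != p.2]].

Lemma mem_flatl i j : i \in flat i j.
Proof. by rewrite inE dot_crossl. Qed.

Lemma mem_flatr i j : j \in flat i j.
Proof. by rewrite inE dot_crossr. Qed.

Lemma flatP X : reflect (exists i j, i != j /\ X = flat i j) (X \in flats).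
Proof.
apply: (iffP imsetP) => [[[i j]]|[i [j [ij ->]]]].
  by rewrite inE => /= ij ->; exists i, j.
by exists (i, j); rewrite ?inE.
Qed.

Lemma mem_flats i j : i != j -> flat i j \in flats.
Proof. by move=> ij; apply/flatP; exists i, j. Qed.

Hypothesis hA : line_arrangement A.

Lemma arr_neq0 i : A i != 0.
Proof. by case: hA. Qed.

Lemma arr_scale i j (k : K) : A i = k *: A j -> i = j.
Proof.
move=> e; case: hA => A0; apply.
have k0 : k != 0 by apply: contra_neq (A0 i) => k0; rewrite e k0 scale0r.
rewrite e; apply/eqmxP; exact: eqmx_scale.
Qed.

Lemma vertex_neq0 i j : i != j -> vertex i j != 0.
Proof.
apply: contraNneq => /(cross_eq0 (arr_neq0 i)) [k e].
exact/eqP/esym/(arr_scale e).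
Qed.

Lemma vertex_scale i j k l : i != j -> k != l -> k \in flat i j -> l \in flat i j ->
  exists2 c, c != 0 & vertex k l = c *: vertex i j.
Proof.
move=> ij kl; rewrite !inE => /eqP hk /eqP hl.
have [c e] := cross_span (vertex_neq0 kl) hk hl.
have c0 : c != 0.
  by apply: contra_neq (vertex_neq0 ij); rewrite e => ->; rewrite scale0r.
by exists c^-1; rewrite ?invr_eq0 // e scalerA mulVf // scale1r.
Qed.

Lemma flat_eq i j k l : i != j -> k != l -> k \in flat i j -> l \in flat i j ->
  flat k l = flat i j.
Proof.
move=> ij kl hk hl; have [c c0 e] := vertex_scale ij kl hk hl.
by apply/setP => m; rewrite !inE e dotZr mulf_eq0 (negPf c0).
Qed.

Lemma flats_eq X i j : X \in flats -> i != j -> i \in X -> j \in X -> X = flat i j.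
Proof. by move=> /flatP [k [l [kl ->]]] ij hi hj; rewrite (flat_eq kl ij). Qed.

Lemma flatsP2 X i : X \in flats -> i \in X ->
  exists j, [/\ i != j, j \in X & X = flat i j].
Proof.
move=> hX iX; have /flatP[k [l [kl e]]] := hX.
have [ik|ik] := eqVneq i k.
  by exists l; rewrite e ik mem_flatr.
by exists k; split=> //; [rewrite e mem_flatl|apply: flats_eq; rewrite ?e ?mem_flatl// -e].
Qed.

Lemma card_flats X : X \in flats -> (1 < #|X|)%N.
Proof.
move=> /flatP [i [j [ij ->]]]; apply/card_gt1P.
by exists i, j; rewrite mem_flatl mem_flatr.
Qed.

(** Double count of the ordered pairs of distinct lines: each pair lies in exactly one flat. *)
Lemma sum_pairs_flats :
  (\sum_(X in flats) #|X| * (#|X| - 1) = d * (d - 1))%N.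
Proof.
have cnt (X : {set 'I_d}) :
    (#|X| * (#|X| - 1))%N = (\sum_(i in X) \sum_(j in X | j != i) 1)%N.
  rewrite -sum_nat_const; apply: eq_bigr => i iX.
  rewrite sum1_card (cardD1 i) iX addKn.
  by apply: eq_card => j; rewrite !inE andbC.
have := cnt setT; rewrite cardsT card_ord => ->.
rewrite (eq_bigr _ (fun X _ => cnt X)).
transitivity (\sum_(X in flats) \sum_i \sum_(j | (j != i) && (flat i j == X)) 1)%N.
  apply: eq_bigr => X hX; rewrite big_mkcond; apply: eq_bigr => i _.
  case: ifP => iX.
    apply: eq_bigl => j; rewrite andbC; apply: andb_id2l => ji.
    apply/idP/eqP => [jX|<-]; last exact: mem_flatr.
    by rewrite -(flats_eq hX) // eq_sym.
  rewrite big1 // => j /andP[_ /eqP e]; by rewrite -e mem_flatl in iX.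
rewrite exchange_big /= [RHS]big_mkcond; apply: eq_bigr => i _; rewrite inE.
rewrite (eq_bigl (fun j => j != i)); last by move=> j; rewrite inE.
rewrite (partition_big (flat i) (mem flats)) //= => j ji.
by apply: mem_flats; rewrite eq_sym.
Qed.

End Flats.

(** * Homogeneous ternary forms *)

Section Homog.
Local Open Scope ring_scope.
Variable K : fieldType.
Local Notation S := {mpoly K[3]}.
Local Notation lf := (@linear_form K).
Implicit Types (p q g r : S) (a b x v : 'rV[K]_3).

Lemma var_homog i : ('X_i : S) \is 1.-homog.
Proof. by rewrite dhomogX; apply/eqP/mdeg1. Qed.

(** Forms are sums of monomials, and a monomial of positive degree has a variable as a factor. The
    predicate carries the degree so that statements may depend on it. *)
Lemma dhomog_ind (P : nat -> S -> Prop) :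
  (forall k, P k 0) -> (forall k p q, P k p -> P k q -> P k (p + q)) ->
  (forall k c p, P k p -> P k (c *: p)) -> P 0%N 1 ->
  (forall k i p, p \is k.-homog -> P k p -> P k.+1 ('X_i * p)) ->
  forall k p, p \is k.-homog -> P k p.
Proof.
move=> P0 PD PZ P1 PX k p hp; rewrite (mpolyE p) big_seq.
apply: (big_ind (P k)); [exact: P0|exact: PD|move=> m mp; apply: PZ].
have {mp hp} <- : mdeg m = k by exact: (dhomog_mf hp).
elim: {m}(mdeg m) {-2}m (erefl (mdeg m)) => [m /eqP|n IH m e].
  by rewrite mdeg_eq0 => /eqP ->; rewrite mpolyX0 ?mdeg0.
have [i mi] : exists i, (0 < m i)%N.
  apply/existsP; apply: contra_eqT e; rewrite negb_exists mdegE => /forallP h.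
  rewrite big1 // => i _; apply/eqP; have := h i; by rewrite -eqn0Ngt.
have le : (U_(i) <= m)%MM by rewrite lep1mP -lt0n.
have em : mdeg (m - U_(i))%MM = n.
  by apply/succn_inj; rewrite -e -[in RHS](submK le) mdegD mdeg1 addn1.
rewrite -(submK le) addmC mpolyXD mdegD mdeg1 em; apply: PX.
  by rewrite dhomogX; apply/eqP.
by rewrite -{1}em; apply: IH.
Qed.

Lemma dhomog0C p : p \is 0.-homog -> p = (p@_0)%:MP.
Proof.
move=> hp; apply/mpolyP => m; rewrite mcoeffC; case: eqVneq => [->|m0].
  by rewrite mulr1.
by rewrite mulr0 (dhomog_nemf_coeff hp) //= mdeg_eq0.
Qed.

Lemma lfE a : lf a = (a 0 0)%:MP * 'X_0 + (a 0 1)%:MP * 'X_1 + (a 0 2)%:MP * 'X_2.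
Proof. by rewrite /linear_form sum3 !mul_mpolyC. Qed.

Lemma lfD a b : lf (a + b) = lf a + lf b.
Proof. by rewrite !lfE !mxE !mpolyCD; ring. Qed.

Lemma lfZ c a : lf (c *: a) = c%:MP * lf a.
Proof. by rewrite !lfE !mxE !mpolyCM; ring. Qed.

Lemma lf_homog a : lf a \is 1.-homog.
Proof. by apply: rpred_sum => i _; apply: rpredZ; apply: var_homog. Qed.

Lemma lf_delta i : lf (delta_mx 0 i) = 'X_i.
Proof.
rewrite /linear_form (bigD1 i) //= mxE !eqxx scale1r big1 ?addr0 // => j ji.
by rewrite mxE (negPf ji) andbF scale0r.
Qed.

Lemma lf_basis (a b c x : 'rV[K]_3) : dot c (cross a b) != 0 ->
  exists l m n, lf x = l%:MP * lf a + m%:MP * lf b + n%:MP * lf c.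
Proof.
move=> abc; have /(congr1 lf) := dot_cramer a b c x; rewrite !lfD !lfZ => e.
have u : (dot c (cross a b))^-1%:MP * (dot c (cross a b))%:MP = 1 :> S.
  by rewrite -mpolyCM mulVf.
exists ((dot c (cross a b))^-1 * dot x (cross b c)).
exists ((dot c (cross a b))^-1 * dot x (cross c a)).
exists ((dot c (cross a b))^-1 * dot x (cross a b)).
rewrite !mpolyCM -!mulrA -!mulrDr -e mulrA u mul1r //.
Qed.

Definition dderiv v p : S := \sum_(i < 3) v 0 i *: p^`M(i).

Lemma dderivM v p q : dderiv v (p * q) = dderiv v p * q + p * dderiv v q.
Proof.
rewrite /dderiv mulr_suml mulr_sumr -big_split /=; apply: eq_bigr => i _.
by rewrite mderivM scalerDr scalerAl scalerAr.
Qed.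

Lemma mderiv_var i j : ('X_j : S)^`M(i) = (i == j)%:R.
Proof.
rewrite mderivX mnm1E eq_sym; case: eqP => [->|_]; last by rewrite scale0r.
rewrite scale1r -[X in 'X_[X]](_ : 0%MM = _) ?mpolyX0 //.
by apply/mnmP => t; rewrite !mnmE subnn.
Qed.

Lemma dderiv_lf v a : dderiv v (lf a) = (dot a v)%:MP.
Proof.
rewrite /dderiv sum3 lfE !mderivD !mderiv_mulC !mderiv_var /=.
by rewrite dotE !mpolyCD !mpolyCM -!mul_mpolyC; ring.
Qed.

Lemma mderiv_homog k i p : p \is k.-homog -> p^`M(i) \is k.-1.-homog.
Proof.
move: k p; apply: (dhomog_ind (P := fun k p => p^`M(i) \is k.-1.-homog)).
- by move=> k; rewrite mderiv0 rpred0.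
- by move=> k p q hp hq; rewrite mderivD rpredD.
- by move=> k c p hp; rewrite mderivZ rpredZ.
- by rewrite -mpolyC1 mderivC rpred0.
move=> k j p hp hd; rewrite mderivM rpredD //=.
  by rewrite mderiv_var; case: eqP; rewrite ?mul1r ?mul0r ?rpred0.
case: k hp hd => [hp _|k hp hd]; last first.
  by rewrite -[k.+1]/(1 + k)%N dhomogM // var_homog.
by rewrite (dhomog0C hp) mderivC mulr0 rpred0.
Qed.

Lemma dderiv_homog v k p : p \is k.-homog -> dderiv v p \is k.-1.-homog.
Proof.
by move=> hp; apply: rpred_sum => i _; apply/rpredZ/mderiv_homog.
Qed.

Lemma euler k p : p \is k.-homog -> \sum_i 'X_i * p^`M(i) = p *+ k.
Proof.
move: k p; apply: (dhomog_ind (P := fun k p => \sum_i 'X_i * p^`M(i) = p *+ k)).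
- by move=> k; rewrite mul0rn big1 // => i _; rewrite mderiv0 mulr0.
- move=> k p q hp hq; rewrite mulrnDl -hp -hq -big_split /=.
  by apply: eq_bigr => i _; rewrite mderivD mulrDr.
- move=> k c p hp; rewrite scalerMnr -hp scaler_sumr.
  by apply: eq_bigr => i _; rewrite mderivZ scalerAr.
- by rewrite mulr0n big1 // => i _; rewrite -mpolyC1 mderivC mulr0.
move=> k i p _ hp.
rewrite mulrS -mulrnAr -hp mulr_sumr.
rewrite (bigD1 i) // [in RHS](bigD1 i) //= addrA; congr (_ + _).
  by rewrite mderivM mderiv_var eqxx /=; ring.
apply: eq_bigr => j ji; rewrite mderivM mderiv_var (negPf ji) /=; ring.
Qed.

End Homog.

(** * Local conditions at an intersection point *)

Section Local.
Local Open Scope ring_scope.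
Variable K : fieldType.
Local Notation S := {mpoly K[3]}.
Local Notation lf := (@linear_form K).
Implicit Types (p q g r : S) (l u w v : 'rV[K]_3).

Lemma lf_exp_homog l n : lf l ^+ n \is n.-homog.
Proof. by rewrite -[X in X.-homog]mul1n; apply/dhomogMn/lf_homog. Qed.

Lemma lf_powers_homog u w k j : (j <= k)%N ->
  lf u ^+ j * lf w ^+ (k - j) \is k.-homog.
Proof.
move=> jk; by rewrite -[X in X.-homog](subnKC jk); apply: dhomogM; apply: lf_exp_homog.
Qed.

(** The determinant condition makes [l], [u], [w] a basis of the linear forms; modulo [l] a form
    becomes a binary form in [u] and [w]. Degree [k.+1] gives the cofactor degree [k] without
    subtraction. *)
Lemma line_expansion l u w k g : dot w (cross l u) != 0 -> g \is k.+1.-homog ->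
  exists r (c : nat -> K), r \is k.-homog /\
    g = lf l * r + \sum_(j < k.+2) (c j)%:MP * (lf u ^+ j * lf w ^+ (k.+1 - j)).
Proof.
move=> luw.
pose Q k g := exists r (c : nat -> K), r \is k.-homog /\
    g = lf l * r + \sum_(j < k.+2) (c j)%:MP * (lf u ^+ j * lf w ^+ (k.+1 - j)).
(* A constant has no cofactor of degree -1, so degree 0 gets a statement of its own. *)
pose P k g := if k is k'.+1 then Q k' g else exists c, g = c%:MP.
suff: forall k g, g \is k.-homog -> P k g by move=> h /h.
have Q0 n : Q n 0.
  exists 0, (fun=> 0); rewrite rpred0 mulr0 add0r big1 // => i _.
  by rewrite mpolyC0 mul0r.
have QD n p q : Q n p -> Q n q -> Q n (p + q).
  move=> [r [c [hr ->]]] [r' [c' [hr' ->]]].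
  exists (r + r'), (fun j => c j + c' j); split; first exact: rpredD.
  rewrite mulrDr addrACA -big_split /=; congr (_ + _).
  by apply: eq_bigr => j _; rewrite mpolyCD mulrDl.
have QZ n (b : K) p : Q n p -> Q n (b%:MP * p).
  move=> [r [c [hr ->]]].
  exists (b%:MP * r), (fun j => b * c j).
  split; first by rewrite mul_mpolyC rpredZ.
  rewrite mulrDr mulr_sumr mulrCA; congr (_ + _).
  by apply: eq_bigr => j _; rewrite mpolyCM mulrA.
apply: dhomog_ind.
- by case=> [|n] /=; [exists 0; rewrite mpolyC0|exact: Q0].
- case=> [|n] p q /=; last exact: QD.
  by move=> [c ->] [c' ->]; exists (c + c'); rewrite mpolyCD.
- case=> [|n] c p /=; last by rewrite -mul_mpolyC; apply/QZ.
  by move=> [c' ->]; exists (c * c'); rewrite mpolyCM mul_mpolyC.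
- by exists 1; rewrite mpolyC1.
move=> n i p hp.
(* Multiplying by a variable reduces to multiplying by [l], [u] and [w]: the first goes entirely
   into the cofactor, the second shifts the coefficients, the third keeps them. *)
have {i} [e1 [e2 [e3 <-]]] : exists x y z : K,
    x%:MP * lf l + y%:MP * lf u + z%:MP * lf w = 'X_i.
  rewrite -lf_delta; have [x [y [z e]]] := lf_basis (delta_mx 0 i) luw.
  by exists x, y, z.
case: n hp => [_ [b ->]|n hp [r [c [hr e]]]] /=; rewrite !mulrDl.
  rewrite -!(mulrA _ _ b%:MP).
  apply/QD; last apply/QZ; first apply/QD; try apply/QZ.
  - exists b%:MP, (fun=> 0); rewrite -alg_mpolyC rpredZ ?dhomog1 //; split=> //.
    by rewrite big1 ?addr0 // => i _; rewrite mpolyC0 mul0r.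
  - exists 0, (fun j => if j == 1%N then b else 0); rewrite rpred0; split=> //.
    rewrite !big_ord_recl big_ord0 /= /bump /= mpolyC0; ring.
  - exists 0, (fun j => if j == 0%N then b else 0); rewrite rpred0; split=> //.
    rewrite !big_ord_recl big_ord0 /= /bump /= mpolyC0; ring.
rewrite -!(mulrA _ _ p).
apply/QD; last apply/QZ; first apply/QD; try apply/QZ.
- exists p, (fun=> 0); split=> //.
  by rewrite big1 ?addr0 // => i _; rewrite mpolyC0 mul0r.
- exists (lf u * r), (fun j => if j is j'.+1 then c j' else 0).
  split; first by rewrite -(add1n n) dhomogM // lf_homog.
  rewrite e mulrDr mulrCA; congr (_ + _).
  rewrite [RHS]big_ord_recl /= mpolyC0 mul0r add0r mulr_sumr.
  apply: eq_bigr => j _; rewrite /bump /= add1n subSS exprS; ring.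
- exists (lf w * r), (fun j => if (j < n.+2)%N then c j else 0).
  split; first by rewrite -(add1n n) dhomogM // lf_homog.
  rewrite e mulrDr mulrCA; congr (_ + _).
  rewrite [RHS]big_ord_recr /= ltnn mpolyC0 mul0r addr0 mulr_sumr.
  apply: eq_bigr => j _; rewrite ltn_ord.
  by rewrite [(n.+2 - j)%N]subSn -1?ltnS // exprS; ring.
Qed.

(* [A] restricts to a nonzero multiple of [u ^ m] on the line [l = 0]. *)
Definition pure_mod l u m (A : S) := exists (c : K) s,
  [/\ c != 0, A = c%:MP * lf u ^+ m + lf l * s &
      s = 0 \/ (0 < m)%N /\ s \is m.-1.-homog].

(** On [l = 0] the form [A] is a nonzero multiple of [u ^ m], so it absorbs all monomials with
    exponent of [u] at least [m]; only [m] coefficients survive. *)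
Lemma pure_expansion l u w m A k : dot w (cross l u) != 0 -> pure_mod l u m A ->
  (m <= k)%N -> (0 < k)%N -> forall g, g \is k.-homog ->
  exists r b (c : nat -> K), r \is k.-1.-homog /\
    g = lf l * r + A * b + \sum_(j < m) (c j)%:MP * (lf u ^+ j * lf w ^+ (k - j)).
Proof.
move=> luw [c [s [c0 eA hs]]]; case: k => // k mk _ g.
move=> /(line_expansion luw)[r [f [hr ->]]] /=.
(* [t] is the tail of the binary form divided by [u ^ m]; replacing [u ^ m] by [c^-1 A] changes the
   cofactor of [l] by [c^-1 s t]. *)
pose t := \sum_(m <= j < k.+2) (f j)%:MP * (lf u ^+ (j - m) * lf w ^+ (k.+1 - j)).
have ht : t \is (k.+1 - m).-homog.
  rewrite /t big_nat; apply: rpred_sum => j /andP[mj jk]; rewrite mul_mpolyC.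
  apply: rpredZ; rewrite (_ : k.+1 - j = k.+1 - m - (j - m))%N; last by lia.
  by apply: lf_powers_homog; lia.
exists (r - (c^-1)%:MP * s * t), ((c^-1)%:MP * t), f; split.
  rewrite rpredB // -mulrA mul_mpolyC rpredZ //.
  case: hs => [->|[m0 hs]]; first by rewrite mul0r rpred0.
  by rewrite (_ : k = m.-1 + (k.+1 - m))%N ?dhomogM //; lia.
rewrite -!(big_mkord xpredT (fun j => (f j)%:MP * (lf u ^+ j * lf w ^+ (k.+1 - j)))).
rewrite (@big_cat_nat _ _ _ m) //=; last by lia.
have -> : \sum_(m <= j < k.+2) (f j)%:MP * (lf u ^+ j * lf w ^+ (k.+1 - j)) =
    lf u ^+ m * t.
  rewrite mulr_sumr; apply: eq_big_nat => j /andP[mj _].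
  rewrite (_ : lf u ^+ j = lf u ^+ m * lf u ^+ (j - m)); first by ring.
  by rewrite -exprD subnKC.
have cc : c%:MP * (c^-1)%:MP = 1 :> S by rewrite -mpolyCM mulfV.
have -> : A * ((c^-1)%:MP * t) = lf u ^+ m * t + lf l * ((c^-1)%:MP * s * t).
  rewrite -[lf u ^+ m * t]mul1r -cc eA; ring.
ring.
Qed.

(* The spanning family [e] depends only on [k], not on the form being expanded. *)
Definition spanned_mod k n (P : S -> Prop) :=
  exists (I : finType) (e : I -> S), [/\ #|I| = n, forall t, e t \is k.-homog &
    forall g, g \is k.-homog -> exists r (c : I -> K),
      P r /\ g = r + \sum_t (c t)%:MP * e t].

Lemma prod_lf_homog (s : seq 'rV[K]_3) :
  \prod_(l <- s) lf l \is (size s).-homog.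
Proof.
elim: s => [|l s IH] /=; first by rewrite big_nil dhomog1.
by rewrite big_cons -(add1n (size s)) dhomogM ?lf_homog.
Qed.

(** The lines are divided out one after the other; each lowers the degree of the cofactor by 1 and
    leaves [m] residual coefficients. *)
Lemma lines_expansion (s : seq 'rV[K]_3) m A k :
  {in s, forall l, exists u w, dot w (cross l u) != 0 /\ pure_mod l u m A} ->
  (m + size s <= k)%N ->
  spanned_mod k (m * size s) (fun g => exists r b,
    r \is (k - size s).-homog /\ g = \prod_(l <- s) lf l * r + A * b).
Proof.
elim: s => [|l s IH] /= hs mk.
  exists void, (fun=> 0); split=> [|//|g hg]; first by rewrite muln0 card_void.
  exists g, (fun=> 0); split; last by rewrite big1 ?addr0 // => -[].
  by exists g, 0; rewrite big_nil mul1r mulr0 addr0 subn0.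
have [||I [e [cI he ex]]] := IH.
- by move=> l' l's; apply: hs; rewrite inE l's orbT.
- by lia.
have [u [w [luw pA]]] := hs l (mem_head _ _).
pose B := \prod_(l <- s) lf l.
exists (I + 'I_m)%type.
(* The residual monomials of [l] are multiplied by the product [B] of the lines divided out before
   it. *)
exists (fun t : I + 'I_m => match t with inl t => e t
  | inr j => B * (lf u ^+ j * lf w ^+ (k - size s - j)) end).
split.
- by rewrite card_sum cI card_ord mulnS addnC.
- case=> [t|j]; first exact: he.
  have -> : k.-homog = (size s + (k - size s)).-homog :> qualifier 0 S.
    by congr (_.-homog); lia.
  rewrite dhomogM ?prod_lf_homog ?lf_powers_homog //.
  by have := ltn_ord j; lia.
move=> g /ex[_ [c [[r [b [hr ->]]] ->]]].
have [||r' [b' [c' [hr' ->]]]] := pure_expansion luw pA _ _ hr; [lia|lia|].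
exists (lf l * B * r' + A * (b + B * b')).
exists (fun t : I + 'I_m => match t with inl t => c t | inr j => c' j end); split.
  exists r', (b + B * b'); rewrite big_cons; split=> //.
  by move: hr'; rewrite subnS.
rewrite big_sumType /= -/B.
have -> : \sum_(j < m) (c' j)%:MP * (B * (lf u ^+ j * lf w ^+ (k - size s - j))) =
    B * \sum_(j < m) (c' j)%:MP * (lf u ^+ j * lf w ^+ (k - size s - j)).
  by rewrite mulr_sumr; apply: eq_bigr => j _; ring.
ring.
Qed.

End Local.

Section Pure.
Local Open Scope ring_scope.
Variable K : fieldType.
Local Notation S := {mpoly K[3]}.
Local Notation lf := (@linear_form K).
Implicit Types (p q g r : S) (l u w v : 'rV[K]_3).

Lemma pure_mod1 l u : pure_mod l u 0 1.
Proof.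
exists 1, 0; rewrite oner_eq0; split=> //; last by left.
by rewrite expr0 mpolyC1 mulr0 addr0 mulr1.
Qed.

(** A line through the point [l = u = 0] other than [l] restricts to a nonzero multiple of [u] on
    [l = 0]. *)
Lemma pure_modM l u m B (x y : K) : y != 0 -> pure_mod l u m B ->
  pure_mod l u m.+1 (lf (x *: l + y *: u) * B).
Proof.
move=> y0 [c [s [c0 -> hs]]].
exists (y * c), ((x * c)%:MP * lf u ^+ m + s * lf (x *: l + y *: u)); split.
- by rewrite mulf_neq0.
- by rewrite lfD !lfZ !mpolyCM exprS; ring.
right; split=> //=; apply: rpredD.
  by rewrite mul_mpolyC rpredZ // lf_exp_homog.
case: hs => [->|[m0 hs]]; first by rewrite mul0r rpred0.
by have := dhomogM hs (lf_homog (x *: l + y *: u)); rewrite addn1 prednK.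
Qed.

(** By Leibniz the derivative of [l B] along [v] is [dot l v] times [B] modulo [l]. *)
Lemma pure_mod_deriv l u v m B : dot l v != 0 -> B \is m.-homog ->
  pure_mod l u m B -> pure_mod l u m (dderiv v (lf l * B)).
Proof.
move=> lv hB [c [s [c0 eB hs]]].
exists (dot l v * c), ((dot l v)%:MP * s + dderiv v B); split.
- by rewrite mulf_neq0.
- by rewrite dderivM dderiv_lf {1}eB mpolyCM; ring.
case: m hB eB hs => [|m] hB eB hs.
  left; case: hs => [->|[]//]; rewrite mulr0 add0r (dhomog0C hB) -[_%:MP]mulr1.
  by rewrite mul_mpolyC /dderiv big1 // => i _; rewrite mderivZ -mpolyC1 mderivC !scaler0.
right; split=> //; rewrite rpredD ?(dderiv_homog _ hB) //.
by case: hs => [->|[_ hs]]; rewrite ?mulr0 ?rpred0 // mul_mpolyC rpredZ.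
Qed.

End Pure.

Section LocalSpan.
Local Open Scope ring_scope.
Variables (K : fieldType) (d : nat) (A : 'I_d -> 'rV[K]_3).
Hypothesis hA : line_arrangement A.
Local Notation S := {mpoly K[3]}.
Local Notation lf := (@linear_form K).

(** Let [m = #|X|] and [h = l0 B] with [l0] the line [i0]. Restricted to [l0], the derivative of [h]
    along [v'] is pure of degree [m - 1] and leaves [m - 1] conditions. As [v] lies on [l0], the
    derivative of [h] along [v] is [l0 D_v B], so the cofactor of [l0] is reduced modulo [B] and
    [D_v B], with [m - 2] conditions on each of the other [m - 1] lines. The total [(m - 1)^2] is
    the Milnor number of an ordinary [m]-fold point. *)
Lemma local_span (X : {set 'I_d}) k : X \in flats A -> (2 * #|X| <= k)%N ->
  spanned_mod k ((#|X| - 1) ^ 2) (fun g => exists v v' b0 b1 b2,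
    let h := \prod_(i in X) lf (A i) in
    g = h * b0 + dderiv v h * b1 + dderiv v' h * b2).
Proof.
move=> hX mk.
have [i0 [j0 [ij eX]]] := flatP _ _ hX.
(* [t] is a line missing the point; it completes any two lines of [X] to a basis. *)
have [t pt] := dot_neq0 (vertex_neq0 hA ij).
have det i j : i \in X -> j \in X -> i != j -> dot t (cross (A i) (A j)) != 0.
  rewrite eX => iX jX ne; have [c c0 e] := vertex_scale hA ij ne iX jX.
  by rewrite -/(vertex A i j) e dotZr mulf_neq0 // dotC.
have i0X : i0 \in X by rewrite eX mem_flatl.
pose s := enum (X :\ i0).
have sX i : (i \in s) = (i != i0) && (i \in X) by rewrite mem_enum !inE.
have us : uniq s by exact: enum_uniq.
have szs : size s = (#|X| - 1)%N by rewrite -cardE (cardsD1 i0 X) i0X addKn.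
have X2 : (1 < #|X|)%N by exact: card_flats hX.
pose B := \prod_(i <- s) lf (A i).
have eh : \prod_(i in X) lf (A i) = lf (A i0) * B.
  rewrite (bigD1 i0) //= /B big_enum /=; congr (_ * _).
  by apply: eq_bigl => i; rewrite !inE andbC.
have hB (s' : seq 'I_d) : \prod_(i <- s') lf (A i) \is (size s').-homog.
  by rewrite -(big_map A xpredT) -(size_map A) prod_lf_homog.
have pure i j (s' : seq 'I_d) : i \in X -> j \in X -> i != j ->
    {in s', forall k, k != i /\ k \in X} ->
    pure_mod (A i) (A j) (size s') (\prod_(i <- s') lf (A i)).
  move=> iX jX ne; elim: s' => [|n s' IH] hs.
    by rewrite big_nil; apply: pure_mod1.
  have [ni nX] := hs n (mem_head _ _); rewrite big_cons.
  have [x [y e]] : exists x y, A n = x *: A i + y *: A j.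
    apply: dot_cross_eq0; first exact: vertex_neq0.
    by move: nX; rewrite (flats_eq hA hX ne iX jX) inE => /eqP.
  rewrite e; apply: pure_modM; last first.
    by apply: IH => k' hk; apply: hs; rewrite inE hk orbT.
  apply: contra_neq ni => y0; move: e; rewrite y0 scale0r addr0.
  exact: (arr_scale hA).
(* [v'] lies off the line [i0], while [v] is the point where [i0] meets [t], which is on no other
   line of [X]. *)
have [v' v'0] := dot_neq0 (arr_neq0 hA i0).
pose v := cross (A i0) t.
have v0 : dot (A i0) v = 0 by rewrite dot_crossl.
have vi i : i \in s -> dot (A i) v != 0.
  rewrite sX => /andP[ne iX].
  by rewrite /v dot_cross_rot dot_cross_rot det.
have [||I [e [cI he ex]]] :=
    @lines_expansion _ (map A s) (#|X| - 2) (dderiv v B) k.-1.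
- move=> _ /mapP[i si ->]; exists (A i0), t.
  have := si; rewrite sX => /andP[ne iX]; rewrite det //; split=> //.
  have -> : B = lf (A i) * \prod_(j <- rem i s) lf (A j) by rewrite /B (big_rem i).
  have -> : (#|X| - 2)%N = size (rem i s) by rewrite size_rem // szs; clear; lia.
  apply: pure_mod_deriv; [exact: vi|exact: hB|].
  apply: pure => // k'; rewrite mem_rem_uniq // !inE sX.
  by case/and3P.
- by rewrite size_map szs; clear -mk X2; lia.
have j0s : j0 \in s by rewrite sX eq_sym ij eX mem_flatr.
have j0X : j0 \in X by rewrite eX mem_flatr.
have p1 : pure_mod (A i0) (A j0) (#|X| - 1) (dderiv v' (lf (A i0) * B)).
  apply: pure_mod_deriv => //; first by rewrite -szs hB.
  by rewrite -szs; apply: pure => // k'; rewrite sX => /andP[].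
have dt := det _ _ i0X j0X ij.
exists (I + 'I_(#|X| - 1))%type.
exists (fun z : I + 'I_(#|X| - 1) => match z with inl z => lf (A i0) * e z
  | inr j => lf (A j0) ^+ j * lf t ^+ (k - j) end).
split.
- by rewrite card_sum cI card_ord size_map szs; clear -X2; nia.
- case=> [z|j].
    have -> : k.-homog = (1 + k.-1).-homog :> qualifier 0 S.
      by congr (_.-homog); clear -mk X2; lia.
    by rewrite dhomogM ?lf_homog.
  by apply: lf_powers_homog; have := ltn_ord j; clear -mk; lia.
move=> g hg.
have [||r [b [c [hr ->]]]] := pure_expansion dt p1 _ _ hg; try by clear -mk X2; lia.
have [_ [c' [[r' [b' [_ ->]] ->]]]] := ex _ hr.
rewrite big_map -/B eh.
exists (lf (A i0) * B * r' + dderiv v (lf (A i0) * B) * b' +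
  dderiv v' (lf (A i0) * B) * b).
exists (fun z : I + 'I_(#|X| - 1) => match z with inl z => c' z | inr j => c j end).
split; first by exists v, v', r', b', b.
rewrite big_sumType /=.
have -> : \sum_i (c' i)%:MP * (lf (A i0) * e i) = lf (A i0) * \sum_i (c' i)%:MP * e i.
  by rewrite mulr_sumr; apply: eq_bigr => z _; ring.
by rewrite [dderiv v (lf _ * _)]dderivM dderiv_lf v0 mpolyC0; ring.
Qed.

End LocalSpan.

(** * The Jacobian ideal of an arrangement *)

Section Jacobian.
Local Open Scope ring_scope.
Variables (K : fieldType) (d : nat) (A : 'I_d -> 'rV[K]_3).
Hypothesis d0 : (d%:R : K) != 0.
Local Notation S := {mpoly K[3]}.
Local Notation lf := (@linear_form K).
Local Notation f := (defining_poly A).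
Local Notation J := (jacobian_ideal f).
Implicit Types (p q g r : S) (X : {set 'I_d}).

Lemma jac0 : J 0.
Proof. by exists (fun=> 0); rewrite big1 // => i _; rewrite mul0r. Qed.

Lemma jacD p q : J p -> J q -> J (p + q).
Proof.
move=> [a ->] [b ->]; exists (fun i => a i + b i).
by rewrite -big_split; apply: eq_bigr => i _; rewrite mulrDl.
Qed.

Lemma jacM p q : J q -> J (p * q).
Proof.
move=> [a ->]; exists (fun i => p * a i).
by rewrite mulr_sumr; apply: eq_bigr => i _; rewrite mulrA.
Qed.

Lemma jac_dderiv v : J (dderiv v f).
Proof.
by exists (fun i => (v 0 i)%:MP); apply: eq_bigr => i _; rewrite mul_mpolyC.
Qed.

Lemma defining_poly_homog : f \is d.-homog.
Proof.
rewrite /defining_poly -[X in X.-homog](size_enum_ord d) -big_enum /=.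
by rewrite -(big_map A xpredT) -(size_map A) prod_lf_homog.
Qed.

(** Euler's identity puts [d] times [f] into the ideal, and [d] is invertible in [K]. *)
Lemma jac_defining_poly : J f.
Proof.
have := euler defining_poly_homog; rewrite -mulr_natl -mpolyC_nat => e.
have {2}<- : (d%:R^-1)%:MP * \sum_i 'X_i * f^`M(i) = f.
  by rewrite e mulrA -mpolyCM mulVf // mpolyC1 mul1r.
by apply: jacM; exists (fun i => 'X_i).
Qed.

Definition off_lines (X : {set 'I_d}) : S := \prod_(i in ~: X) lf (A i).

Lemma off_linesE X : off_lines X = \prod_(i | i \notin X) lf (A i).
Proof. by apply: eq_bigl => i; rewrite inE. Qed.

Lemma defining_poly_split X : f = (\prod_(i in X) lf (A i)) * off_lines X.
Proof.
by rewrite off_linesE /defining_poly (bigID (mem X)).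
Qed.

(** With [f = h q] the Leibniz rule gives [q^2 D_w h = q D_w f - (D_w q) f], which is where the
    square comes from. *)
Lemma jac_local X v v' b0 b1 b2 : let h := \prod_(i in X) lf (A i) in
  J (off_lines X ^+ 2 * (h * b0 + dderiv v h * b1 + dderiv v' h * b2)).
Proof.
move=> h; set q := off_lines X.
have ef : f = h * q by exact: defining_poly_split.
have D w : J (q ^+ 2 * dderiv w h).
  have -> : q ^+ 2 * dderiv w h = q * dderiv w f + (- dderiv w q) * f.
    by rewrite {1}ef ef dderivM; ring.
  by apply: jacD; apply: jacM; [exact: jac_dderiv|exact: jac_defining_poly].
have -> : q ^+ 2 * (h * b0 + dderiv v h * b1 + dderiv v' h * b2) =
    q * b0 * f + b1 * (q ^+ 2 * dderiv v h) + b2 * (q ^+ 2 * dderiv v' h).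
  rewrite {1}ef; ring.
by apply: jacD; [apply: jacD|]; apply: jacM; rewrite //; exact: jac_defining_poly.
Qed.

Hypothesis hsat : saturated J.

Lemma sat_vars g : (forall i, J ('X_i * g)) -> J g.
Proof.
move=> h; apply: (hsat (k := 1)) => _ [a ->]; rewrite mulr_suml.
apply: (big_ind J); [exact: jac0|exact: jacD|] => s _.
by rewrite big_ord1 -mulrA; apply/jacM/h.
Qed.

Lemma sat_lines (a b c : 'rV[K]_3) g : dot c (cross a b) != 0 ->
  J (lf a * g) -> J (lf b * g) -> J (lf c * g) -> J g.
Proof.
move=> abc Ja Jb Jc; apply: sat_vars => i; rewrite -lf_delta.
have [x [y [z ->]]] := lf_basis (delta_mx 0 i) abc.
rewrite !mulrDl -!(mulrA _ _ g).
by apply: jacD; [apply: jacD|]; apply: jacM.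
Qed.

(* Removes the linear factors one at a time: as long as the lines with exponent below 2 are
   not concurrent, three of them span the linear forms and saturation applies. *)
Lemma sat_off_lines g : (1 < d)%N ->
  (forall X, X \in flats A -> J (off_lines X ^+ 2 * g)) -> J g.
Proof.
move=> d1 hX.
(* The induction is on the total deficiency of the exponents below 2; the lemma is the case where
   all exponents are 0. *)
suff claim n : forall e : 'I_d -> nat, (\sum_i (2 - e i) <= n)%N ->
    J ((\prod_i lf (A i) ^+ e i) * g).
  have := claim _ (fun=> 0%N) (leqnn _).
  by rewrite big1 ?mul1r // => i _; rewrite expr0.
have base (e : 'I_d -> nat) X : X \in flats A ->
    (forall i, i \notin X -> (2 <= e i)%N) -> J ((\prod_i lf (A i) ^+ e i) * g).
  move=> XF he; rewrite (bigID (mem X)) /=.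
  have -> : \prod_(i | i \notin X) lf (A i) ^+ e i =
      off_lines X ^+ 2 * \prod_(i | i \notin X) lf (A i) ^+ (e i - 2).
    rewrite off_linesE -prodrXl -big_split /=; apply: eq_bigr => i iX.
    by rewrite -exprD subnKC // he.
  by rewrite mulrCA -mulrA mulrCA; apply: jacM; exact: hX.
elim: n => [|n IH] e he.
  apply: (base e (flat A (Ordinal (ltnW d1)) (Ordinal d1))); first exact: mem_flats.
  move=> i _; move: he; rewrite leqn0 sum_nat_eq0 => /forallP /(_ i).
  by rewrite subn_eq0.
have [[X XF hXe]|no] := pselect (exists2 X, X \in flats A &
    forall i, i \notin X -> (2 <= e i)%N); first exact: base hXe.
have ex X : X \in flats A -> exists2 i, i \notin X & (e i < 2)%N.
  move=> XF; apply/not_exists2P => h; apply: no; exists X => // i iX.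
  by case: (h i) => // /negP; rewrite -leqNgt.
have [i _ ei] := ex _ (mem_flats A (isT : Ordinal (ltnW d1) != Ordinal d1)).
(* Some flat contains [i]; the line [j] chosen off it therefore differs from [i], and [k] is then
   chosen off the flat of [i] and [j]. *)
have [i' ii'] : exists i', i != i'.
  have [->|ne] := eqVneq i (Ordinal d1); last by exists (Ordinal d1).
  by exists (Ordinal (ltnW d1)).
have [j jX ej] := ex _ (mem_flats A ii').
have ij : i != j by apply: contraNneq jX => <-; rewrite mem_flatl.
have [k kX ek] := ex _ (mem_flats A ij).
rewrite inE in kX.
have step t : (e t < 2)%N -> J (lf (A t) * (\prod_i lf (A i) ^+ e i * g)).
  move=> et; have -> : lf (A t) * (\prod_i lf (A i) ^+ e i * g) =
      (\prod_i lf (A i) ^+ (e i + (i == t))) * g.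
    rewrite (bigD1 t) //= [in RHS](bigD1 t) //= eqxx addn1 exprS !mulrA.
    congr (_ * _ * _); apply: eq_bigr => s /negPf ->.
    by rewrite addn0.
  apply: IH; rewrite -ltnS; apply: leq_trans he.
  rewrite (bigD1 t) //= [X in (_ < X)%N](bigD1 t) //= eqxx.
  rewrite [X in (_ + X < _)%N](eq_bigr (fun i => 2 - e i)%N).
    by clear -et; lia.
  by move=> s /negPf ->; rewrite addn0.
by apply: (sat_lines kX); apply: step.
Qed.

End Jacobian.

(** * Linear subspaces and codimension *)

Section Codim.
Local Open Scope ring_scope.
Variables (K : fieldType) (V : vectType K).
Implicit Types (U W : {vspace V}) (P : V -> Prop).

(** A subspace of maximal dimension among those inside [P] is all of [P], since any further vector
    of [P] would enlarge it. This turns membership in an ideal, a mere proposition, into a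
    [vspace]. *)
Lemma subspace_vspace P : P 0 -> (forall u v, P u -> P v -> P (u + v)) ->
  (forall c v, P v -> P (c *: v)) -> exists U, forall v, v \in U <-> P v.
Proof.
move=> P0 PD PZ.
pose Q n := `[< exists U, \dim U = n /\ forall v, v \in U -> P v >].
have Q0 : exists n, Q n.
  exists 0%N; apply/asboolP; exists 0%VS; rewrite dimv0; split=> // v.
  by rewrite memv0 => /eqP ->.
have Qb n : Q n -> (n <= \dim (fullv : {vspace V}))%N.
  by move=> /asboolP[U [<- _]]; exact/dimvS/subvf.
case: (ex_maxnP Q0 Qb) => n /asboolP[U [dU hU]] max.
exists U => v; split; first exact: hU.
move=> Pv.
have /max : Q (\dim (U + <[v]>)).
  apply/asboolP; exists (U + <[v]>)%VS; split=> // w.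
  move=> /memv_addP[u uU [_ /vlineP[k ->] ->]].
  by apply: PD; [exact: hU|exact: PZ].
rewrite -dU => le.
have /eqP -> : U == (U + <[v]>)%VS by rewrite eqEdim addvSl le.
exact: subvP (addvSr U <[v]>) _ (memv_line v).
Qed.

(** Codimension is subadditive under intersection; the bounds are written additively to avoid
    truncated subtraction. *)
Lemma codim_bigcap (I : finType) (D : {set I}) (U : I -> {vspace V}) (n : I -> nat) :
  (forall i, i \in D -> (dim V <= \dim (U i) + n i)%N) ->
  (dim V <= \dim (\bigcap_(i in D) U i) + \sum_(i in D) n i)%N.
Proof.
move=> h; pose P (W : {vspace V}) m := (dim V <= \dim W + m)%N.
apply: (big_rec2 P).
  by rewrite /P dimvf addn0.
move=> i W m iD; rewrite /P => hW; have := h i iD.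
have := dimv_sum_cap (U i) W; have := dimvS (subvf (U i + W)); rewrite dimvf.
move: hW; clear; lia.
Qed.

Lemma codim_span U (I : finType) (e : I -> V) :
  (forall v, exists c : I -> K, v - \sum_i c i *: e i \in U) ->
  (dim V <= \dim U + #|I|)%N.
Proof.
move=> h; rewrite -dimvf.
have -> : #|I| = size [seq e i | i <- enum I] by rewrite size_map cardE.
apply: (@leq_trans (\dim (U + <<[seq e i | i <- enum I]>>))); last first.
  apply: leq_trans (dimv_add_leqif _ _) _.
  by rewrite leq_add2l dim_span.
apply/dimvS/subvP => v _; have [c hc] := h v.
rewrite -(subrK (\sum_i c i *: e i) v); apply: memv_add => //.
apply: memv_suml => i _; apply/memvZ/memv_span/mapP; exists i => //.
by rewrite mem_enum.
Qed.

End Codim.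

(** * The dimension count for a saturated Jacobian ideal *)

Section Count.
Local Open Scope ring_scope.
Variable K : fieldType.
Local Notation S := {mpoly K[3]}.

Lemma pihomogM k e (a f : S) : f \is e.-homog ->
  pihomog mdeg (k + e) (a * f) = pihomog mdeg k a * f.
Proof.
move=> hf.
have [N kN aN] : exists2 N, (k < N)%N & (msize a <= N)%N.
  by exists (maxn k.+1 (msize a)); rewrite ?leq_maxr // leq_maxl.
rewrite {1}(@pihomog_partitionE _ _ mdeg N a aN) mulr_suml raddf_sum /=.
rewrite (bigD1 (Ordinal kN)) //= big1 ?addr0 => [|j jk].
  by rewrite pihomog_dE // dhomogM // pihomogP.
have h : pihomog mdeg j a * f \is (j + e).-homog by rewrite dhomogM // pihomogP.
by rewrite (pihomog_ne0 _ h) // eqn_add2r; apply: contra_neq jk => e'; apply/val_inj.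
Qed.

Definition dhomog_of k (p : S) (hp : p \is k.-homog) : dhomog 3 K k := DHomog hp.

Variables (d : nat) (A : 'I_d -> 'rV[K]_3).
Hypothesis hA : line_arrangement A.
Hypothesis d0 : (d%:R : K) != 0.
Local Notation f := (defining_poly A).
Local Notation J := (jacobian_ideal f).

(** Coefficients may be replaced by their homogeneous components of degree [k - d.-1]; products of a
    basis of such forms with the three partial derivatives then span everything. *)
Lemma dim_jacobian k (U : {vspace dhomog 3 K k}) : (d.-1 <= k)%N ->
  (forall g, g \in U -> J (val g)) ->
  (\dim U <= 3 * 'C(k - d.-1 + 2, k - d.-1))%N.
Proof.
move=> dk hU; set k' := (k - d.-1)%N.
have hf i : f^`M(i) \is d.-1.-homog by apply/mderiv_homog/defining_poly_homog.
have hb (b : dhomog 3 K k') i : val b * f^`M(i) \is k.-homog.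
  by rewrite -(subnK dk) dhomogM // dhomog_is_dhomog.
pose B := vbasis {: dhomog 3 K k'}.
pose G (z : 'I_(\dim {: dhomog 3 K k'}) * 'I_3) := dhomog_of (hb B`_(z.1) z.2).
have -> : (3 * 'C(k' + 2, k') =
    size [seq G z | z <- enum {: 'I_(\dim {: dhomog 3 K k'}) * 'I_3}])%N.
  by rewrite size_map -cardE card_prod !card_ord dimvf mulnC.
apply: (leq_trans _ (dim_span _)); apply/dimvS/subvP => g /hU [a e].
have {a e}[a e] : exists a : 'I_3 -> dhomog 3 K k', val g = \sum_i val (a i) * f^`M(i).
  exists (fun i => dhomog_of (pihomogP mdeg k' (a i))).
  rewrite -(pihomog_dE (dhomog_is_dhomog g)) e raddf_sum /=.
  by apply: eq_bigr => i _; rewrite -(pihomogM _ _ (hf i)) subnK.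
have -> : g = \sum_i \sum_t coord B t (a i) *: G (t, i).
  apply/val_inj; rewrite e raddf_sum; apply: eq_bigr => i _.
  rewrite raddf_sum {1}(coord_vbasis (memvf (a i))) raddf_sum mulr_suml.
  by apply: eq_bigr => t _; rewrite /= scalerAl.
apply: memv_suml => i _; apply: memv_suml => t _.
by apply/memvZ/memv_span/mapP; exists (t, i) => //; rewrite mem_enum.
Qed.

(** The forms meeting the local conditions at all points have codimension at most the sum of
    squares, and saturation puts them into the ideal, where [dim_jacobian] bounds their
    dimension. *)
Theorem saturated_count k : saturated J -> (1 < d)%N -> (d.-1 <= k)%N ->
  (forall X, X \in flats A -> (2 * #|X| <= k)%N) ->
  ('C(k + 2, k) <= 3 * 'C(k - d.-1 + 2, k - d.-1) +
     \sum_(X in flats A) (#|X| - 1) ^ 2)%N.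
Proof.
move=> hsat d1 dk hk.
have hU (X : {set 'I_d}) : exists U : {vspace dhomog 3 K k},
    forall g, g \in U <-> J (off_lines A X ^+ 2 * val g).
  apply: subspace_vspace => [|u v hu hv|c v hv].
  - by rewrite mulr0; apply: jac0.
  - by rewrite mulrDr; apply: jacD.
  - by rewrite /= -scalerAr -mul_mpolyC; apply: jacM.
pose U X := projT1 (cid (hU X)).
have UP X g : g \in U X <-> J (off_lines A X ^+ 2 * val g) by rewrite /U; case: cid.
have codim X : X \in flats A -> (dim (dhomog 3 K k) <= \dim (U X) + (#|X| - 1) ^ 2)%N.
  move=> XF; have [I [e [<- he ex]]] := local_span hA XF (hk X XF).
  apply: (@codim_span _ _ _ I (fun t => dhomog_of (he t))) => g.
  have [r [c [[v [v' [b0 [b1 [b2 hr]]]]] eg]]] := ex _ (dhomog_is_dhomog g).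
  exists c; apply/UP.
  have -> : val (g - \sum_i c i *: dhomog_of (he i)) = r.
    rewrite raddfB raddf_sum /= [X in X - _]eg
      [X in _ - X](_ : _ = \sum_i (c i)%:MP * e i) ?addrK //.
    by apply: eq_bigr => i _; rewrite mul_mpolyC.
  by rewrite hr; apply: jac_local.
have h1 := codim_bigcap codim.
have h2 : (\dim (\bigcap_(X in flats A) U X) <= 3 * 'C(k - d.-1 + 2, k - d.-1))%N.
  apply: dim_jacobian => // g hg; apply: (sat_off_lines hsat d1) => X XF.
  by apply/UP; move/subvP: (bigcapv_inf X XF (subvv (U X))); apply.
by apply: (leq_trans h1); rewrite leq_add2r.
Qed.

End Count.

(** * Counting topes *)

Section Topes.
Local Open Scope ring_scope.
Variables (R : realFieldType) (d : nat) (A : 'I_d -> 'rV[R]_3).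
Implicit Types (i j k : 'I_d) (B S : {set 'I_d}) (s : {ffun 'I_d -> bool}).
Implicit Types (x y u v : 'rV[R]_3).

Lemma small_perturbation (I : finType) (F G : I -> R) :
  exists2 e, 0 < e & forall i : I, F i != 0 -> `|e * G i| < `|F i|.
Proof.
(* Since [x / 0 = 0], indices with [F i = 0] contribute nothing; the summand 1 in [1 + M] gives
   strictness. *)
pose M := \sum_i `|G i| / `|F i|.
have M0 : 0 <= M by apply: sumr_ge0 => i _; rewrite divr_ge0.
have M1 : 0 < 1 + M by lra.
exists (1 + M)^-1; first by rewrite invr_gt0.
move=> i Fi; have Fi0 : 0 < `|F i| by rewrite normr_gt0.
rewrite normrM gtr0_norm ?invr_gt0 // mulrC ltr_pdivrMr // -ltr_pdivrMl //.
rewrite mulrC; apply: (@le_lt_trans _ _ M); last by lra.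
rewrite /M (bigD1 i) //= lerDl.
by apply: sumr_ge0 => j _; rewrite divr_ge0.
Qed.

Definition sdot s i x : R := if s i then dot (A i) x else - dot (A i) x.

Lemma sdotD s i x y : sdot s i (x + y) = sdot s i x + sdot s i y.
Proof. by rewrite /sdot dotDr; case: ifP => _; ring. Qed.

Lemma sdotZ s i (c : R) x : sdot s i (c *: x) = c * sdot s i x.
Proof. by rewrite /sdot dotZr; case: ifP => _; ring. Qed.

Lemma sdotN s i x : sdot s i (- x) = - sdot s i x.
Proof. by rewrite /sdot dotNr; case: ifP => _; ring. Qed.

Lemma sdot_eq0 s i x : (sdot s i x == 0) = (dot (A i) x == 0).
Proof. by rewrite /sdot; case: ifP => _; rewrite ?oppr_eq0. Qed.

Lemma sdot_ext s s' i x : s i = s' i -> sdot s i x = sdot s' i x.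
Proof. by rewrite /sdot => ->. Qed.

Lemma sdot_perturbation s x u : exists2 e, 0 < e &
  forall i, 0 < sdot s i x -> 0 < sdot s i (x + e *: u) /\ 0 < sdot s i (x - e *: u).
Proof.
have [e e0 h] := small_perturbation (fun i => sdot s i x) (fun i => sdot s i u).
exists e => // i xi; have := h i (lt0r_neq0 xi).
by rewrite -scaleNr !sdotD !sdotZ (gtr0_norm xi) ltr_norml; lra.
Qed.

Definition vanishes B x := forall i, i \in B -> dot (A i) x = 0.

(* Sign vectors realised on [S] by a point of the flat cut out by [B], set to [false]
   outside [S] so that they are determined by their restriction to [S]. *)
Definition tope B S s := exists x, [/\ vanishes B x,
  forall i, i \in S -> 0 < sdot s i x & forall i, i \notin S -> s i = false].

Definition topes B S := [set s | `[< tope B S s >]].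

Definition flip j s : {ffun 'I_d -> bool} := [ffun i => (i == j) (+) s i].

Lemma flipK j : involutive (flip j).
Proof. by move=> s; apply/ffunP => i; rewrite !ffunE addbA addbb. Qed.

Lemma flipE j s : flip j s j = ~~ s j.
Proof. by rewrite ffunE eqxx. Qed.

Lemma flipNE j s i : i != j -> flip j s i = s i.
Proof. by rewrite ffunE => /negPf ->. Qed.

Lemma sdot_flip s j x : sdot (flip j s) j x = - sdot s j x.
Proof. by rewrite /sdot flipE; case: (s j); rewrite ?opprK. Qed.

Lemma sdot_flipN s j i x : i != j -> sdot (flip j s) i x = sdot s i x.
Proof. by move=> ij; apply/sdot_ext/flipNE. Qed.

Lemma vanishesD B x y : vanishes B x -> vanishes B y -> vanishes B (x + y).
Proof. by move=> hx hy i iB; rewrite dotDr hx // hy // addr0. Qed.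

Lemma vanishesZ B (c : R) x : vanishes B x -> vanishes B (c *: x).
Proof. by move=> hx i iB; rewrite dotZr hx // mulr0. Qed.

Lemma vanishesU1 j B x : vanishes (j |: B) x <-> dot (A j) x = 0 /\ vanishes B x.
Proof.
split=> [h|[h0 h] i].
  by split=> [|i iB]; apply: h; rewrite !inE ?eqxx // iB orbT.
by rewrite !inE => /orP[/eqP ->|/h].
Qed.

(** Deletion and restriction: the line [j] cuts in two exactly those topes of [S] that have a point
    on it. The vector [u] shows that [j] does not contain the whole flat of [B]. *)
Lemma card_topes_add B S j u : j \notin S -> vanishes B u -> dot (A j) u != 0 ->
  #|topes B (j |: S)| = (#|topes B S| + #|topes (j |: B) S|)%N.
Proof.
move=> jS uB uj.
(* [N] and [P] hold the sign vectors on [S] realised on the negative and on the positive side of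
   [j], both with [false] at [j] so that they can be compared. *)
pose N := [set s in topes B (j |: S) | ~~ s j].
pose P := [set s | (flip j s \in topes B (j |: S)) && ~~ s j].
have memN s : s \in N <-> [/\ s j = false, forall i, i \notin S -> s i = false &
    exists x, [/\ vanishes B x, forall i, i \in S -> 0 < sdot s i x &
      dot (A j) x < 0]].
  rewrite !inE; split=> [/andP[/asboolP[x [xB xS hs]] /negbTE sj]|[sj hs [x [xB xS xj]]]].
    split=> // [i iS|].
      by have [->//|ij] := eqVneq i j; apply: hs; rewrite !inE negb_or ij.
    exists x; split=> // [i iS|]; first by apply: xS; rewrite !inE iS orbT.
    by have := xS j; rewrite !inE eqxx /sdot sj oppr_gt0; apply.
  rewrite sj andbT; apply/asboolP; exists x; split=> // i.
    by rewrite !inE => /orP[/eqP ->|/xS//]; rewrite /sdot sj oppr_gt0.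
  by rewrite !inE negb_or => /andP[_ /hs].
have memP s : s \in P <-> [/\ s j = false, forall i, i \notin S -> s i = false &
    exists x, [/\ vanishes B x, forall i, i \in S -> 0 < sdot s i x &
      0 < dot (A j) x]].
  have nej i : i \in S -> i != j by apply: contraTneq => ->.
  rewrite !inE; split=> [/andP[/asboolP[x [xB xS hs]] /negbTE sj]|[sj hs [x [xB xS xj]]]].
    split=> // [i iS|].
      have [->//|ij] := eqVneq i j.
      by rewrite -(flipNE s ij); apply: hs; rewrite !inE negb_or ij.
    exists x; split=> // [i iS|].
      by rewrite -(sdot_flipN _ _ (nej _ iS)); apply: xS; rewrite !inE iS orbT.
    by have := xS j; rewrite !inE eqxx /sdot flipE sj; apply.
  rewrite sj andbT; apply/asboolP; exists x; split=> // i.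
    rewrite !inE => /orP[/eqP ->|iS]; first by rewrite /sdot flipE sj.
    by rewrite sdot_flipN ?nej //; apply: xS.
  by rewrite !inE negb_or => /andP[ij iS]; rewrite flipNE // hs.
have cardPN : #|topes B (j |: S)| = (#|P| + #|N|)%N.
  rewrite -(cardsID [set s : {ffun 'I_d -> bool} | s j] (topes B (j |: S))).
  congr (_ + _)%N; last first.
    by apply: eq_card => s; rewrite !inE andbC.
  have -> : topes B (j |: S) :&: [set s : {ffun 'I_d -> bool} | s j] = flip j @: P.
    apply/setP => s; rewrite !inE; apply/idP/imsetP.
      move=> /andP[h sj]; exists (flip j s); last by rewrite flipK.
      by rewrite inE flipK flipE inE h sj.
    by move=> [s']; rewrite !inE => /andP[h sj] ->; rewrite h flipE sj.
  exact/card_imset/inv_inj/flipK.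
rewrite cardPN -cardsUI.
suff [-> ->] : P :|: N = topes B S /\ P :&: N = topes (j |: B) S by [].
split.
  apply/setP => s; rewrite [RHS]inE in_setU; apply/orP/asboolP.
    by case=> [/memP|/memN] [sj hs [x [xB xS xj]]]; exists x.
  move=> [x [xB xS hs]]; have sj := hs _ jS.
  (* A point on the line [j] is pushed off it along [u], which stays in the flat of [B]. *)
  have [xj|xj|xj] := ltrgt0P (dot (A j) x); last 1 first.
  - have [e e0 he] := sdot_perturbation s x u.
    have [uj0|uj0|uj0] := ltrgt0P (dot (A j) u); last by rewrite uj0 eqxx in uj.
      left; apply/memP; split=> //; exists (x + e *: u); split.
      - exact/vanishesD/vanishesZ.
      - by move=> i /xS /he [].
      - by rewrite dotDr dotZr xj add0r mulr_gt0.
    right; apply/memN; split=> //; exists (x + e *: u); split.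
    - exact/vanishesD/vanishesZ.
    - by move=> i /xS /he [].
    - by rewrite dotDr dotZr xj add0r pmulr_rlt0.
  - by left; apply/memP; split=> //; exists x.
  - by right; apply/memN; split=> //; exists x.
apply/setP => s; rewrite [RHS]inE in_setI; apply/andP/asboolP.
  move=> [/memP[sj hs [x [xB xS xj]]] /memN[_ _ [y [yB yS yj]]]].
  exists ((- dot (A j) y) *: x + dot (A j) x *: y); split=> //.
    apply/vanishesU1; split; first by rewrite dotDr !dotZr; ring.
    by apply: vanishesD; apply: vanishesZ.
  move=> i iS; rewrite sdotD !sdotZ addr_gt0 // mulr_gt0 ?oppr_gt0 //;
    by [apply: xS|apply: yS].
move=> [y [/vanishesU1[yj yB] yS hs]]; have sj := hs _ jS.
have [e e0 he] := sdot_perturbation s y u.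
have v1 : vanishes B (y + e *: u) by exact/vanishesD/vanishesZ.
have v2 : vanishes B (y - e *: u) by rewrite -scaleNr; exact/vanishesD/vanishesZ.
have [uj0|uj0|uj0] := ltrgt0P (dot (A j) u); last by rewrite uj0 eqxx in uj.
  split; [apply/memP|apply/memN]; split=> //.
    exists (y + e *: u); split=> // [i /yS /he []//|].
    by rewrite dotDr dotZr yj add0r mulr_gt0.
  exists (y - e *: u); split=> // [i /yS /he []//|].
  by rewrite dotDr dotNr dotZr yj add0r oppr_lt0 mulr_gt0.
split; [apply/memP|apply/memN]; split=> //.
  exists (y - e *: u); split=> // [i /yS /he []//|].
  by rewrite dotDr dotNr dotZr yj add0r oppr_gt0 pmulr_rlt0.
exists (y + e *: u); split=> // [i /yS /he []//|].
by rewrite dotDr dotZr yj add0r pmulr_rlt0.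
Qed.

End Topes.

Lemma set_insert_ind (T : finType) (P : {set T} -> Prop) :
  P set0 -> (forall (x : T) (S : {set T}), x \notin S -> P S -> P (x |: S)) -> forall S, P S.
Proof.
move=> P0 PU S; elim: {S}#|S| {-2}S (erefl #|S|) => [S /eqP|n IH S cS].
  by rewrite cards_eq0 => /eqP ->.
have [x xS] : exists x, x \in S by apply/card_gt0P; rewrite cS.
rewrite -(setD1K xS); apply: PU; first by rewrite !inE eqxx.
by apply: IH; move: cS; rewrite (cardsD1 x S) xS => -[].
Qed.

Section Counting.
Local Open Scope ring_scope.
Variables (R : realFieldType) (d : nat) (A : 'I_d -> 'rV[R]_3).
Hypothesis hA : line_arrangement A.
Implicit Types (i j k : 'I_d) (B S X : {set 'I_d}) (s : {ffun 'I_d -> bool}).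
Implicit Types (x y u v : 'rV[R]_3).

Lemma card_topes0 B : #|topes A B set0| = 1%N.
Proof.
apply/eqP/cards1P; exists [ffun=> false]; apply/setP => s; rewrite !inE.
apply/asboolP/eqP => [[x [_ _ hs]]|->].
  by apply/ffunP => i; rewrite ffunE hs // inE.
exists 0; split=> [i _|i|i _]; rewrite ?inE ?ffunE //.
by rewrite dotE !mxE !mulr0 !addr0.
Qed.

Lemma card_topes_empty B S i : i \in S ->
  (forall x, vanishes A B x -> dot (A i) x = 0) -> #|topes A B S| = 0%N.
Proof.
move=> iS h; apply: eq_card0 => s; rewrite inE; apply/asboolP => -[x [xB xS _]].
by have /lt0r_neq0 := xS i iS; rewrite sdot_eq0 h // eqxx.
Qed.

Lemma vanishes_pair i j x : i != j -> vanishes A [set i; j] x ->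
  exists c : R, x = c *: vertex A i j.
Proof.
move=> ij h; apply: cross_span; first exact: vertex_neq0.
  by apply: h; rewrite !inE eqxx.
by apply: h; rewrite !inE eqxx orbT.
Qed.

Lemma vertex_vanishes i j : vanishes A [set i; j] (vertex A i j).
Proof.
by move=> k; rewrite !inE => /orP[]/eqP->; rewrite (dot_crossl, dot_crossr).
Qed.

(** Two lines cut out the one-dimensional space spanned by their vertex, on which the lines of [S]
    vanish only at the origin; two opposite rays remain. *)
Lemma card_topes2 i j S : i != j -> S != set0 -> (forall k, k \in S -> k \notin flat A i j) ->
  #|topes A [set i; j] S| = 2%N.
Proof.
move=> ij; move: S; apply: set_insert_ind; first by rewrite eqxx.
move=> k S kS IH _ hS.
have kv : dot (A k) (vertex A i j) != 0 by have := hS k (setU11 _ _); rewrite inE.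
rewrite (card_topes_add kS (@vertex_vanishes i j) kv).
have [->|S0] := eqVneq S set0; first by rewrite !card_topes0.
rewrite (IH S0); last by move=> l lS; apply: hS; rewrite !inE lS orbT.
have /set0Pn[l lS] := S0.
rewrite (card_topes_empty lS) // => x /vanishesU1[xk /(vanishes_pair ij)[c e]].
move: xk; rewrite e !dotZr => /eqP; rewrite mulf_eq0 (negPf kv) orbF => /eqP ->.
by rewrite mul0r.
Qed.

Definition meets i S := [set X in flats A | (i \in X) && (X :&: S != set0)].

Lemma meetsU1 i j S : i != j ->
  meets i (j |: S) = flat A i j |: meets i S.
Proof.
move=> ij; apply/setP => X; rewrite !inE.
apply/idP/idP => [/and3P[XF iX /set0Pn[k]]|/orP[/eqP->|/and3P[-> -> /set0Pn[k]]]].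
- rewrite !inE => /andP[kX /orP[/eqP kj|kS]].
    by rewrite (flats_eq hA XF ij iX) ?eqxx // -kj.
  rewrite XF iX; apply/orP; right; apply/set0Pn; exists k.
  by rewrite inE kX.
- rewrite mem_flats // mem_flatl; apply/set0Pn; exists j.
  by rewrite !inE eqxx dot_crossr eqxx.
rewrite inE => /andP[kX kS] /=; apply/set0Pn; exists k.
by rewrite !inE kX kS orbT.
Qed.

(** The points of [meets i S] are lines through the origin in the plane of [i], and [n > 0] such
    lines cut a plane into [2 n] sectors. *)
Lemma card_topes1 i S : i \notin S ->
  #|topes A [set i] S| = if S == set0 then 1%N else (2 * #|meets i S|)%N.
Proof.
move: S; apply: set_insert_ind; first by rewrite eqxx card_topes0.
move=> j S jS IH; rewrite !inE negb_or => /andP[ij iS].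
have -> : (j |: S == set0) = false.
  by apply/negbTE/set0Pn; exists j; rewrite setU11.
have [u uj ui] : exists2 u, dot (A j) u != 0 & vanishes A [set i] u.
  have [x] := dot_neq0 (vertex_neq0 hA ij); rewrite dotC => xij.
  exists (cross (A i) x); last by move=> k; rewrite inE => /eqP->; rewrite dot_crossl.
  by rewrite dot_cross_rot dot_cross_rot dot_cross_swap oppr_eq0.
rewrite (card_topes_add jS ui uj) (IH iS) meetsU1 // cardsU1.
have -> : j |: [set i] = [set i; j] by rewrite setUC.
have [S0|S0] := eqVneq S set0.
  rewrite S0 card_topes0 (_ : meets i set0 = set0) ?inE ?cards0 //.
  by apply/setP => X; rewrite !inE setI0 eqxx !andbF.
have [|fS] := boolP (flat A i j \in meets i S).
  rewrite inE => /and3P[_ _ /set0Pn[k]]; rewrite inE => /andP[kX kS].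
  rewrite (card_topes_empty kS) ?addn0 // => x /(vanishes_pair ij)[c ->].
  by rewrite dotZr; move: kX; rewrite inE => /eqP ->; rewrite mulr0.
rewrite card_topes2 //; first by rewrite mulnDr addnC.
move=> k kS; apply: contra fS => kX.
rewrite inE mem_flats // mem_flatl; apply/set0Pn; exists k.
by rewrite inE kX.
Qed.

(** By deletion and restriction a further line [j] adds twice the number of its points with [S], and
    these are the flats whose summand grows by 1. Truncation makes flats without lines of [S]
    contribute 0. *)
Lemma card_topes S : #|topes A set0 S| =
  if S == set0 then 1%N else (2 + 2 * \sum_(X in flats A) (#|X :&: S| - 1))%N.
Proof.
move: S; apply: set_insert_ind; first by rewrite eqxx card_topes0.
move=> j S jS IH.
have -> : (j |: S == set0) = false.
  by apply/negbTE/set0Pn; exists j; rewrite setU11.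
have [u uj] := dot_neq0 (arr_neq0 hA j).
have u0 : vanishes A set0 u by move=> k; rewrite inE.
rewrite (card_topes_add jS u0 uj) IH setU0 card_topes1 //.
have [->|S0] := eqVneq S set0.
  rewrite big1 // => X _; rewrite setU0; apply/eqP; rewrite subn_eq0.
  by rewrite (leq_trans (subset_leq_card (subsetIr _ _))) // cards1.
rewrite -addnA -mulnDr; congr (_ + _ * _)%N.
have -> : #|meets j S| =
    (\sum_(X in flats A) if (j \in X) && (X :&: S != set0) then 1 else 0)%N.
  by rewrite -sum1_card -big_mkcondr; apply: eq_bigl => X; rewrite inE.
rewrite -big_split /=; apply: eq_bigr => X _.
have -> : #|X :&: (j |: S)| = ((j \in X) + #|X :&: S|)%N.
  rewrite (cardsD1 j) !inE eqxx /= andbT; congr (_ + _)%N.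
  apply: eq_card => k; rewrite !inE; case: eqP => [->|_] //=.
  by rewrite (negPf jS) andbF.
rewrite -cards_eq0; case: (j \in X) => /=; last by rewrite addn0.
by case: #|X :&: S| => [|n] //=; rewrite !subSS subn0 addn1.
Qed.

(* Topes in whose closure the flat cut out by [B] is visible; for [B = [set i]] these are the
   topes with wall [i]. *)
Definition near B s := exists x, vanishes A B x /\ forall i, i \notin B -> 0 < sdot A s i x.

Definition nears B := [set s | `[< near B s >]].

Definition reset j s : {ffun 'I_d -> bool} := [ffun i => (i != j) && s i].

Lemma card_reset j (Y : {set {ffun 'I_d -> bool}}) :
  (forall s, s \in Y -> s j = false) -> #|[set s | reset j s \in Y]| = (2 * #|Y|)%N.
Proof.
move=> hY; set Z := [set s | _].
have e1 : Z :\: [set s : {ffun 'I_d -> bool} | s j] = Y.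
  apply/setP => s; rewrite !inE.
  have cl : s j = false -> reset j s = s.
    by move=> sj; apply/ffunP => i; rewrite ffunE; case: eqP => //= ->; rewrite sj.
  apply/idP/idP => [/andP[/negbTE sj]|sY]; first by rewrite cl.
  by rewrite (hY _ sY) cl ?(hY _ sY).
have e2 : Z :&: [set s : {ffun 'I_d -> bool} | s j] = flip j @: Y.
  apply/setP => s; rewrite !inE; apply/andP/imsetP => [[cY sj]|[s' sY ->]].
    exists (reset j s) => //; apply/ffunP => i; rewrite !ffunE.
    by case: eqP => [->|] //=; rewrite sj.
  rewrite flipE (hY _ sY); split=> //; rewrite [reset j _](_ : _ = s') //.
  apply/ffunP => i; rewrite !ffunE; case: eqP => [->|] //=.
  by rewrite (hY _ sY).
rewrite -(cardsID [set s : {ffun 'I_d -> bool} | s j] Z) e1 e2.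
by rewrite (card_imset _ (inv_inj (flipK j))) addnn mul2n.
Qed.

Lemma nears0 : nears set0 = topes A set0 setT.
Proof.
apply/setP => s; rewrite !inE; apply/asboolP/asboolP => [[x [x0 h]]|[x [x0 h _]]].
  by exists x; split=> // i; rewrite ?inE // => _; apply: h; rewrite inE.
by exists x; split=> // i _; apply: h; rewrite inE.
Qed.

Lemma resetN j s i : i != j -> reset j s i = s i.
Proof. by rewrite ffunE => ->. Qed.

Lemma resetE j s : reset j s j = false.
Proof. by rewrite ffunE eqxx. Qed.

(** [near] leaves the signs on [B] free, whereas [tope] sets them to [false]; each line of [B]
    contributes a factor 2. *)
Lemma card_nears1 i : #|nears [set i]| = (2 * #|topes A [set i] (~: [set i])|)%N.
Proof.
rewrite -(card_reset (j := i)); last first.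
  by move=> s; rewrite inE => /asboolP[x [_ _ hs]]; apply: hs; rewrite !inE eqxx.
apply: eq_card => s; rewrite !inE; apply/asboolP/asboolP.
  move=> [x [xi h]]; exists x; split=> // j; rewrite !inE; last first.
    by rewrite negbK => /eqP ->; rewrite resetE.
  by move=> ji; rewrite (sdot_ext _ _ (resetN s ji)) h // inE.
move=> [x [xi h _]]; exists x; split=> // j; rewrite inE => ji.
by rewrite -(sdot_ext _ _ (resetN s ji)) h // !inE.
Qed.

Lemma card_nears2 i j : i != j ->
  #|nears [set i; j]| = (4 * #|topes A [set i; j] (~: [set i; j])|)%N.
Proof.
move=> ij.
have off s : s \in topes A [set i; j] (~: [set i; j]) -> s i = false /\ s j = false.
  by rewrite inE => /asboolP[x [_ _ hs]]; split; apply: hs; rewrite !inE eqxx ?orbT.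
rewrite -[4%N]/(2 * 2)%N -mulnA -(card_reset (j := i)); last by move=> s /off[].
rewrite -(card_reset (j := j)); last first.
  move=> s; rewrite inE => /off[_]; by rewrite resetN // eq_sym.
have cl s k : k \notin [set i; j] -> reset i (reset j s) k = s k.
  by rewrite !inE negb_or => /andP[ki kj]; rewrite !resetN.
apply: eq_card => s; rewrite !inE; apply/asboolP/asboolP.
  move=> [x [xi h]]; exists x; split=> // k kX; last first.
    move: kX; rewrite !inE negbK => /orP[]/eqP ->; first by rewrite resetE.
    by rewrite resetN 1?eq_sym // resetE.
  by rewrite inE in kX; rewrite (sdot_ext _ _ (cl s k kX)) h.
move=> [x [xi h _]]; exists x; split=> // k kX.
by rewrite -(sdot_ext _ _ (cl s k kX)) h // inE.
Qed.

End Counting.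

(** * Walls of topes *)

Section Generic.
Local Open Scope ring_scope.
Variable R : realFieldType.

(** The planes of [cs] are avoided one after another, by perturbations too small to spoil the
    conditions already secured. *)
Lemma generic_point (I : finType) (F : I -> 'rV[R]_3) (cs : seq 'rV[R]_3) x0 :
  (forall i, 0 < dot (F i) x0) -> {in cs, forall c, c != 0} ->
  exists x, (forall i, 0 < dot (F i) x) /\ {in cs, forall c, dot c x != 0}.
Proof.
move=> h0; elim: cs => [|c cs IH] hcs; first by exists x0.
have [|x [xF xcs]] := IH; first by move=> b bcs; apply: hcs; rewrite inE bcs orbT.
have [cx|cx] := eqVneq (dot c x) 0; last first.
  by exists x; split=> // b; rewrite inE => /orP[/eqP ->|/xcs].
have [u cu] := dot_neq0 (hcs c (mem_head _ _)).
have [e e0 he] := small_perturbation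
  (fun z : I + 'I_(size cs) => match z with inl i => dot (F i) x | inr t => dot cs`_t x end)
  (fun z : I + 'I_(size cs) => match z with inl i => dot (F i) u | inr t => dot cs`_t u end).
exists (x + e *: u); split=> [i|b].
  have := he (inl i) (lt0r_neq0 (xF i)).
  rewrite (gtr0_norm (xF i)) ltr_norml dotDr dotZr; lra.
rewrite inE dotDr dotZr => /orP[/eqP ->|bcs].
  by rewrite cx add0r mulf_neq0 // lt0r_neq0.
have bi : (index b cs < size cs)%N by rewrite index_mem.
have := he (inr (Ordinal bi)); rewrite /= nth_index // => /(_ (xcs b bcs)).
apply: contraTneq => /eqP; rewrite addr_eq0 => /eqP ->.
by rewrite normrN ltxx.
Qed.

End Generic.

Section Walls.
Local Open Scope ring_scope.
Variables (R : realFieldType) (d : nat) (A : 'I_d -> 'rV[R]_3).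
Hypothesis hA : line_arrangement A.
Implicit Types (i j k m n : 'I_d) (B S X : {set 'I_d}) (s : {ffun 'I_d -> bool}).
Implicit Types (x y u v : 'rV[R]_3).
Local Notation nears := (nears A).

Lemma near_sub s B i u : i \in B -> vanishes A (B :\ i) u -> dot (A i) u != 0 ->
  s \in nears B -> s \in nears (B :\ i).
Proof.
move=> iB uB ui; rewrite !inE => /asboolP[x [xB xs]]; apply/asboolP.
wlog ui0 : u uB ui / 0 < sdot A s i u.
  move=> H; have : sdot A s i u != 0 by rewrite sdot_eq0.
  rewrite neq_lt => /orP[neg|pos]; last by apply: (H u).
  apply: (H (- u)); last by rewrite sdotN oppr_gt0.
    by move=> j jB; rewrite dotNr uB // oppr0.
  by rewrite dotNr oppr_eq0.
have [e e0 he] := sdot_perturbation A s x u.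
exists (x + e *: u); split.
  move=> j jB; rewrite dotDr dotZr uB // mulr0 addr0 xB //.
  by move: jB; rewrite !inE => /andP[].
move=> j; rewrite !inE negb_and negbK => /orP[/eqP ->|/xs /he[]//].
by rewrite sdotD sdotZ {1}/sdot xB // oppr0 if_same add0r mulr_gt0.
Qed.

Lemma near_pair s i j : i != j -> s \in nears [set i; j] -> s \in nears [set i].
Proof.
move=> ij; have [x] := dot_neq0 (vertex_neq0 hA ij); rewrite dotC => xij.
have e : [set i; j] :\ j = [set i].
  apply/setP => k; rewrite !inE; have [->|_] := eqVneq k j; last by rewrite orbF.
  by rewrite eq_sym (negPf ij).
rewrite -[in X in _ -> X]e; apply: (near_sub (u := cross (A i) x)).
- by rewrite !inE eqxx orbT.
- by rewrite e => k; rewrite inE => /eqP ->; rewrite dot_crossl.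
by rewrite dot_cross_rot dot_cross_rot dot_cross_swap oppr_eq0.
Qed.

Lemma near_wall s i : s \in nears [set i] -> s \in nears set0.
Proof.
have [u ui] := dot_neq0 (arr_neq0 hA i).
have -> : set0 = [set i] :\ i by rewrite setDv.
by apply: (near_sub (u := u)); rewrite ?inE ?setDv // => k; rewrite inE.
Qed.

Lemma near_flip s B j : j \in B -> s \in nears B -> flip j s \in nears B.
Proof.
move=> jB; rewrite !inE => /asboolP[x [xB xs]]; apply/asboolP; exists x; split=> // i iB.
by rewrite sdot_flipN ?xs //; apply: contraNneq iB => ->.
Qed.

(* A tope is cut out by its walls: a generic point [x] of the tope leaves it in the direction
   [v] through a single line, which is then a wall that [v] crosses. *)
Lemma walls_determine s v : s \in nears set0 ->
  (forall i, s \in nears [set i] -> 0 <= sdot A s i v) -> forall m, 0 <= sdot A s m v.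
Proof.
rewrite inE => /asboolP[x0 [_ hx0]] hv m0; rewrite leNgt; apply/negP => m0v.
pose F i := if s i then A i else - A i.
(* If [v] lies on neither line, the form [c m n] introduced next vanishes at [x] exactly when the
   parameters [t m] and [t n] below agree. *)
have dF i x : dot (F i) x = sdot A s i x.
  by rewrite /F /sdot; case: ifP => // _; rewrite dotC dotNr dotC.
pose c m n := sdot A s n v *: F m - sdot A s m v *: F n.
have dc m n x : dot (c m n) x = sdot A s n v * sdot A s m x - sdot A s m v * sdot A s n x.
  by rewrite dotC dotDr dotNr !dotZr !(dotC x) !dF.
pose cs := [seq c p.1 p.2 | p <- enum {: 'I_d * 'I_d} & (p.1 != p.2) && (sdot A s p.2 v != 0)].
have cs0 : {in cs, forall c, c != 0}.
  move=> z /mapP[[m n] /=]; rewrite mem_filter /= => /andP[/andP[mn nv] _] {z}->.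
  have [x mx nx] : exists2 x, dot (A m) x != 0 & dot (A n) x = 0.
    have [x] := dot_neq0 (vertex_neq0 hA mn); rewrite dotC => xmn.
    exists (cross (A n) x); last by rewrite dot_crossl.
    by rewrite dot_cross_rot dot_cross_rot.
  apply: contraTneq nv => cmn; have := dc m n x; rewrite cmn.
  have /eqP -> : sdot A s n x == 0 by rewrite sdot_eq0 nx.
  rewrite mulr0 subr0 dotE !mxE !mul0r !addr0 => /esym/eqP.
  by rewrite mulf_eq0 sdot_eq0 sdot_eq0 (negPf mx) orbF -(sdot_eq0 A s) => /eqP ->; rewrite eqxx.
have hF i : 0 < dot (F i) x0 by rewrite dF hx0 // inE.
have [x [xF xcs]] := generic_point hF cs0.
have {}xF i : 0 < sdot A s i x by rewrite -dF.
(* [t m] is the parameter at which [x + t v] crosses the line [m]. *)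
pose t m := sdot A s m x / - sdot A s m v.
have [m mv tmin] : exists2 m, sdot A s m v < 0 & forall n, sdot A s n v < 0 -> t m <= t n.
  case: (@arg_minP _ _ _ m0 (fun m => sdot A s m v < 0) t m0v) => m mv h.
  by exists m.
(* The first crossing point lies on the line [m] alone, so [m] is a wall, against [hv]. *)
have mw : s \in nears [set m]; last by have := hv m mw; rewrite leNgt mv.
rewrite inE; apply/asboolP; exists (x + t m *: v); split.
  move=> k; rewrite inE => /eqP ->; apply/eqP; rewrite -(sdot_eq0 A s) sdotD sdotZ.
  by rewrite /t invrN mulrN mulNr divfK ?subrr // lt_eqF.
have tm0 : 0 < t m by rewrite /t divr_gt0 // oppr_gt0.
move=> n; rewrite inE => nm; rewrite sdotD sdotZ.
have [nv|nv] := ltP (sdot A s n v) 0; last first.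
  by rewrite ltr_wpDr // mulr_ge0 // ltW.
have := tmin n nv; rewrite le_eqVlt => /orP[/eqP e|].
  have : c m n \in cs.
    apply/mapP; exists (m, n) => //=; rewrite mem_filter /= mem_enum eq_sym nm /=.
    by rewrite lt_eqF.
  move=> /xcs; rewrite dc => /negP[]; apply/eqP.
  have mv0 : - sdot A s m v != 0 by rewrite oppr_eq0 lt_eqF.
  have nv0 : - sdot A s n v != 0 by rewrite oppr_eq0 lt_eqF.
  by move/eqP: e; rewrite /t eqr_div // => /eqP; lra.
rewrite {2}/t ltr_pdivlMr ?oppr_gt0 //; rewrite mulrN; lra.
Qed.

Definition walls s := [set i | s \in nears [set i]].

Lemma sdot_antisym s m v : 0 <= sdot A s m v -> 0 <= sdot A s m (- v) -> dot (A m) v = 0.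
Proof.
rewrite sdotN oppr_ge0 => h1 h2; apply/eqP; rewrite -(sdot_eq0 A s).
by rewrite eq_le h1 h2.
Qed.

(** If all walls were among two lines, their vertex and its opposite would satisfy the wall
    inequalities, so every line would pass through it. *)
Lemma walls_ge3 s : (1 < d)%N -> (forall i j, i != j -> exists k, k \notin flat A i j) ->
  s \in nears set0 -> (3 <= #|walls s|)%N.
Proof.
move=> d1 ess hs; rewrite ltnNge; apply/negP => w2.
have [i [j [ij wij]]] : exists i j, i != j /\ walls s \subset [set i; j].
  have ex i : exists j, i != j.
    have [->|ne] := eqVneq i (Ordinal d1); last by exists (Ordinal d1).
    by exists (Ordinal (ltnW d1)).
  have [e|[i iw]] := set_0Vmem (walls s).
    have [j ij] := ex (Ordinal d1); exists (Ordinal d1), j; rewrite ij e.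
    by rewrite sub0set.
  have [e|[j jw]] := set_0Vmem (walls s :\ i).
    have [j ij] := ex i; exists i, j; rewrite ij; split=> //.
    apply/subsetP => k kw; have := in_set0 k.
    by rewrite -e in_setD1 kw andbT => /negbFE /eqP ->; rewrite !inE eqxx.
  move: jw; rewrite in_setD1 => /andP[ji jw]; exists i, j; rewrite eq_sym ji; split=> //.
  apply/subsetP => k kw; rewrite !inE; apply/negPn/negP; rewrite negb_or => /andP[ki kj].
  suff : (2 < #|walls s|)%N by rewrite ltnNge w2.
  apply/card_gt2P; exists i, j, k; split; split=> //; by rewrite 1?eq_sym.
have [k] := ess i j ij; rewrite inE => /eqP; apply.
have hw l : s \in nears [set l] -> dot (A l) (vertex A i j) = 0.
  by move=> lw; apply: vertex_vanishes; apply: (subsetP wij); rewrite inE.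
by apply: (@sdot_antisym s); apply: walls_determine => // l /hw e;
  rewrite ?sdotN /sdot e ?oppr0 if_same ?oppr0.
Qed.

(* For a representative [v] of the third vertex of the triangle, [v] satisfies the wall
   inequalities of [s] and [- v] those of [flip i s], so all lines but [i] contain it. *)
Lemma triangle_two_doubles s i j k : i != j -> i != k -> j != k ->
  flat A i j = [set i; j] ->
  s \in nears [set i; j] -> s \in nears [set i; k] ->
  (forall s', s' \in nears set0 -> #|walls s'| = 3) ->
  forall m, m != i -> m \in flat A j k.
Proof.
move=> ij ik jk fij nij nik w3 m mi.
have swap (a b : 'I_d) : [set a; b] = [set b; a] by rewrite setUC.
have wE s' : s' \in nears [set i; j] -> s' \in nears [set i; k] ->
    s' \in nears set0 /\ walls s' = [set i; j; k].
  move=> h1 h2; have s0 := near_wall (near_pair ij h1); split=> //.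
  apply/esym/eqP; rewrite eqEcard w3 // -setUA !cardsU1 cards1 !inE.
  rewrite (negPf ij) (negPf ik) (negPf jk) andbT.
  apply/subsetP => l; rewrite 2!in_setU !in_set1 => /or3P h; rewrite inE.
  case: h => /eqP ->.
  - exact: near_pair h1.
  - by apply: (near_pair (j := i)); rewrite 1?eq_sym // swap.
  - by apply: (near_pair (j := i)); rewrite 1?eq_sym // swap.
have [s0 ws] := wE s nij nik.
(* Both pairs contain [i], so [flip i s] lies at the same two points and has the same three
   walls. *)
have [s0' ws'] : flip i s \in nears set0 /\ walls (flip i s) = [set i; j; k].
  by apply: wE; apply: near_flip; rewrite // !inE eqxx.
have [v [vi vj vk]] : exists v,
    [/\ 0 < sdot A s i v, dot (A j) v = 0 & dot (A k) v = 0].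
  have : sdot A s i (vertex A j k) != 0.
    rewrite sdot_eq0; apply/negP => /eqP e.
    have : k \in flat A i j by rewrite inE /vertex dot_cross_rot -/(vertex A j k) e.
    by rewrite fij !inE eq_sym (negPf ik) eq_sym (negPf jk).
  rewrite neq_lt => /orP[neg|pos]; last first.
    by exists (vertex A j k); rewrite dot_crossl dot_crossr.
  by exists (- vertex A j k); rewrite sdotN oppr_gt0 !dotNr dot_crossl dot_crossr oppr0.
have zero s' a : dot (A a) v = 0 -> 0 <= sdot A s' a v /\ 0 <= sdot A s' a (- v).
  by rewrite sdotN /sdot => ->; rewrite oppr0 if_same oppr0.
suff mv : dot (A m) v = 0.
  rewrite inE; have vjk : vanishes A [set j; k] v.
    by move=> l; rewrite !inE => /orP[]/eqP->.
  have [c e] := vanishes_pair hA jk vjk.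
  move: mv; rewrite e dotZr => /eqP; rewrite mulf_eq0 => /orP[/eqP c0|//].
  by move: vi; rewrite e c0 scale0r /sdot dotE !mxE !mulr0 !addr0 oppr0 if_same ltxx.
apply: (@sdot_antisym s).
  apply: walls_determine => // l lw; have : l \in walls s by rewrite inE.
  rewrite ws !inE => /orP[/orP[]|] /eqP ->; first exact: ltW.
    by case: (zero s _ vj).
  by case: (zero s _ vk).
rewrite -(sdot_flipN A s _ mi); apply: walls_determine => // l lw.
have : l \in walls (flip i s) by rewrite inE.
rewrite ws' !inE => /orP[/orP[]|] /eqP ->.
- by rewrite sdotN sdot_flip opprK ltW.
- by case: (zero (flip i s) _ vj).
by case: (zero (flip i s) _ vk).
Qed.

End Walls.

(** * Numerical conclusion *)

Section Melchior.
Variables (R : realFieldType) (d : nat) (A : 'I_d -> 'rV[R]_3).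
Hypothesis hA : line_arrangement A.
Hypothesis d1 : 1 < d.
Implicit Types (i j k m : 'I_d) (X Y : {set 'I_d}) (s : {ffun 'I_d -> bool}).

Lemma card_nears0 : #|nears A set0| = 2 + 2 * \sum_(X in flats A) (#|X| - 1).
Proof.
rewrite nears0 (card_topes hA) -cards_eq0 cardsT card_ord.
have -> : (d == 0) = false by case: d d1.
by congr (_ + _ * _); apply: eq_bigr => X _; rewrite setIT.
Qed.

(** Double count of the pairs of a tope and one of its walls: the plane of a line is cut into two
    sectors per point on it, and each sector bounds one tope on either side. *)
Lemma sum_walls :
  \sum_(s in nears A set0) #|walls A s| = 4 * \sum_(X in flats A) #|X|.
Proof.
transitivity (\sum_i #|nears A [set i]|).
  rewrite (eq_bigr (fun s => \sum_i (s \in nears A [set i] : nat))); last first.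
    move=> s _; rewrite -sum1_card [LHS]big_mkcond; apply: eq_bigr => i _.
    by rewrite [i \in _]inE; case: (s \in _).
  rewrite exchange_big; apply: eq_bigr => i _ /=.
  rewrite -sum1_card [RHS]big_mkcond [LHS]big_mkcond; apply: eq_bigr => s _.
  have := @near_wall _ _ _ hA s i; case: (s \in nears A [set i]) => [->//|_].
  by case: ifP.
have c i : #|nears A [set i]| = 4 * \sum_(X in flats A) (i \in X).
  rewrite card_nears1 card_topes1 //; last by rewrite !inE eqxx.
  have [j ij] : exists j, i != j.
    have [->|ne] := eqVneq i (Ordinal d1); last by exists (Ordinal d1).
    by exists (Ordinal (ltnW d1)).
  have -> : (~: [set i] == set0) = false.
    by apply/negbTE/set0Pn; exists j; rewrite !inE eq_sym.
  rewrite mulnA; congr (_ * _); rewrite -sum1_card [LHS]big_mkcond [RHS]big_mkcond.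
  apply: eq_bigr => X _; rewrite inE; case: ifP => [/and3P[-> -> _]//|].
  case: ifP => //= XF; case iX : (i \in X) => //= /negbT/negP[]; apply/set0Pn.
  have [k [ik kX _]] := flatsP2 hA XF iX.
  by exists k; rewrite !inE kX eq_sym.
rewrite (eq_bigr _ (fun i _ => c i)) -big_distrr /= exchange_big; congr (_ * _).
apply: eq_bigr => X _; rewrite -sum1_card [RHS]big_mkcond.
by apply: eq_bigr => i _; case: (i \in X).
Qed.

Hypothesis ess : forall i j, i != j -> exists k, k \notin flat A i j.

(** Every tope has at least three walls. With [t_k] the number of [k]-fold points this reads
    [3 + \sum_k (k - 3) t_k <= 0] over the integers. *)
Lemma melchior :
  3 * (2 + 2 * \sum_(X in flats A) (#|X| - 1)) <= 4 * \sum_(X in flats A) #|X|.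
Proof.
rewrite -card_nears0 -sum_walls -sum1_card big_distrr /=.
by apply: leq_sum => s sF; rewrite muln1; apply: walls_ge3.
Qed.

Definition doubles := [set X in flats A | #|X| == 2].

Lemma doubleP X i : X \in doubles -> i \in X ->
  exists j, [/\ i != j, X = flat A i j & X = [set i; j]].
Proof.
rewrite inE => /andP[XF /eqP X2] iX; have [j [ij jX e]] := flatsP2 hA XF iX.
exists j; split=> //; apply/esym/eqP; rewrite eqEcard X2 cards2 ij andbT.
by apply/subsetP => k; rewrite !inE => /orP[]/eqP->.
Qed.

(** Two opposite rays, times four choices of signs for the two lines. *)
Lemma card_nears_double X : X \in doubles -> #|nears A X| = 8.
Proof.
move=> XD; have [i iX] : exists i, i \in X.
  by apply/card_gt0P; move: XD; rewrite inE => /andP[_ /eqP ->].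
have [j [ij e1 e2]] := doubleP XD iX.
rewrite e2 (card_nears2 _ ij) card_topes2 //.
  have [k kX] := ess ij; apply/set0Pn; exists k.
  by rewrite in_setC -e2 e1.
by move=> k; rewrite in_setC -e2 e1.
Qed.

(* In the equality case of Melchior's inequality every region is a triangle, hence has at most
   one ordinary double point among its vertices, whereas each double point lies on eight topes. *)
Lemma melchior_equality :
  (forall i j, i != j -> #|flat A i j| < d.-1) ->
  4 * \sum_(X in flats A) #|X| = 3 * (2 + 2 * \sum_(X in flats A) (#|X| - 1)) ->
  8 * #|doubles| <= 2 + 2 * \sum_(X in flats A) (#|X| - 1).
Proof.
move=> small; rewrite -card_nears0 -sum_walls => e.
(* Equality of the sums forces each term, being at least 3, to equal 3. *)
have w3 s : s \in nears A set0 -> #|walls A s| = 3.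
  move=> s0; apply/eqP; rewrite eqn_leq (walls_ge3 hA d1 ess s0) andbT leqNgt.
  apply/negP => w4; move: e; rewrite -sum1_card big_distrr /=.
  rewrite (bigD1 s) //= [X in _ = X](bigD1 s) //= muln1 => e.
  have : \sum_(t in nears A set0 | t != s) 3 <=
         \sum_(t in nears A set0 | t != s) #|walls A t|.
    by apply: leq_sum => t /andP[t0 _]; apply: walls_ge3.
  by move=> /(leq_add w4); rewrite e addSn ltnn.
have nw X i s : X \in doubles -> s \in nears A X -> i \in X -> i \in walls A s.
  move=> XD sX iX; have [j [ij _ eX]] := doubleP XD iX.
  by rewrite inE; apply: (near_pair hA ij); rewrite -eX.
have -> : 8 * #|doubles| = \sum_(X in doubles) #|nears A X|.
  by rewrite (eq_bigr _ card_nears_double) sum_nat_const mulnC.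
(* Double count of the pairs of a tope and a double point on it; it remains to see that a tope has
   at most one. *)
have -> : \sum_(X in doubles) #|nears A X| =
    \sum_(s in nears A set0) #|[set X in doubles | s \in nears A X]|.
  transitivity (\sum_(X in doubles) \sum_(s in nears A set0) (s \in nears A X : nat)).
    apply: eq_bigr => X XD; rewrite -sum1_card [LHS]big_mkcond [RHS]big_mkcond.
    apply: eq_bigr => s _; case sX : (s \in nears A X); last by case: ifP.
    have [i iX] : exists i, i \in X.
      by apply/card_gt0P; move: XD; rewrite inE => /andP[_ /eqP ->].
    have := nw _ _ _ XD sX iX; rewrite inE => /(near_wall hA) -> //.
  rewrite exchange_big; apply: eq_bigr => s _ /=.
  rewrite -[RHS]sum1_card [LHS]big_mkcond [RHS]big_mkcond; apply: eq_bigr => X _.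
  by rewrite !inE; case: (X \in flats A) => //=; case: (#|X| == 2) => //=; case: ifP.
rewrite -sum1_card; apply: leq_sum => s s0.
rewrite leqNgt; apply/negP => /card_gt1P[X [Y [hX hY XY]]].
have [XD sX] : X \in doubles /\ s \in nears A X by move: hX; rewrite inE => /andP[].
have [YD sY] : Y \in doubles /\ s \in nears A Y by move: hY; rewrite inE => /andP[].
(* Two double points of a triangular tope share a line, as their union lies among its three
   walls. *)
have /card_gt0P[i iXY] : 0 < #|X :&: Y|.
  have : #|X :|: Y| <= #|walls A s|.
    apply/subset_leq_card/subsetP => i; rewrite in_setU => /orP[iX|iY].
      exact: (nw _ _ _ XD sX iX).
    exact: (nw _ _ _ YD sY iY).
  rewrite (w3 _ s0); have := cardsUI X Y.
  move: XD YD; rewrite !inE => /andP[_ /eqP ->] /andP[_ /eqP ->].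
  clear; lia.
move: iXY; rewrite inE => /andP[iX iY].
have [j [ij e1 e2]] := doubleP XD iX; have [k [ik e3 e4]] := doubleP YD iY.
have jk : j != k by apply: contraNneq XY => jk; rewrite e2 e4 jk.
have := small j k jk; rewrite ltnNge => /negP; apply.
have -> : d.-1 = #|[set~ i]| by rewrite cardsC1 card_ord.
apply/subset_leq_card/subsetP => m; rewrite in_setC in_set1 => mi.
apply: (triangle_two_doubles (s := s) hA ij ik jk _ _ _ w3 mi).
- by rewrite -e1.
- by rewrite -e2.
by rewrite -e4.
Qed.

End Melchior.

(** * Numbers of double, triple and quadruple points *)

Section Numeric.
Variables (K : fieldType) (d : nat) (A : 'I_d -> 'rV[K]_3).
Hypothesis h234 : forall X, X \in flats A -> [|| #|X| == 2, #|X| == 3 | #|X| == 4].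

Definition num_flats k := #|[set X in flats A | #|X| == k]|.

Lemma sum_flats (F : nat -> nat) : \sum_(X in flats A) F #|X| =
  num_flats 2 * F 2 + num_flats 3 * F 3 + num_flats 4 * F 4.
Proof.
have e k : num_flats k * F k = \sum_(X in flats A) (#|X| == k) * F k.
  rewrite -big_distrl /=; congr (_ * _); rewrite /num_flats -sum1_card.
  rewrite [LHS]big_mkcond [RHS]big_mkcond; apply: eq_bigr => X _.
  by rewrite inE; case: (X \in flats A) => //=; case: (#|X| == k).
rewrite !e -!big_split; apply: eq_bigr => X /h234 /=.
by case/or3P => /eqP ->; rewrite /= ?mul0n ?mul1n ?addn0.
Qed.

End Numeric.

Lemma double_bin_triangular k : 2 * 'C(k + 2, k) = (k + 2) * (k + 1).
Proof.
have := bin_ffact (k + 2) 2; rewrite -[X in 'C(k + 2, X)](addKn k 2) bin_sub ?leq_addr //.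
by rewrite mulnC !ffactnS ffactn0 muln1 addn2 addn1.
Qed.

(* The witness [k] is [3e/2 - 1] or [3(e - 1)/2], where the gap is maximal. *)
Lemma binomial_gap e : 1 < e -> exists2 k, e <= k &
  forall t, 'C(k + 2, k) <= 3 * 'C(k - e + 2, k - e) + t -> 3 * e ^ 2 <= 4 * t.
Proof.
move=> e1; set a := e./2; have ee : e = odd e + a.*2 by rewrite odd_double_half.
have a1 : 0 < a by rewrite half_gt0.
(* The gap [C(k + 2, 2) - 3 C(k - e + 2, 2)] is [3 a^2 + 3 a + 1] for [e = 2 a + 1] and [3 a^2] for
   [e = 2 a]. *)
case: (odd e) ee => /= ee.
  exists (3 * a); first lia.
  move=> t; rewrite (_ : 3 * a - e = a - 1); last lia.
  have := double_bin_triangular (3 * a); have := double_bin_triangular (a - 1); nia.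
exists (3 * a - 1); first lia.
move=> t; rewrite (_ : 3 * a - 1 - e = a - 1); last lia.
have := double_bin_triangular (3 * a - 1); have := double_bin_triangular (a - 1); nia.
Qed.

(** * From real to complex coordinates *)

Section Complexify.
Variables (R : realType) (d : nat) (A : 'I_d -> 'rV[R]_3).

Lemma dot_map (a b : 'rV[R]_3) :
  dot (map_mx (real_complex R) a) (map_mx (real_complex R) b) = real_complex R (dot a b).
Proof. by rewrite !dotE !mxE !rmorphD !rmorphM. Qed.

Lemma cross_map (a b : 'rV[R]_3) :
  cross (map_mx (real_complex R) a) (map_mx (real_complex R) b) =
  map_mx (real_complex R) (cross a b).
Proof. by apply/rowP => i; rewrite !mxE !rmorphB !rmorphM. Qed.

(** Vertices are given by polynomial formulas in the real coordinates, so extending scalars changes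
    no incidence. *)
Lemma flat_complexify i j : flat (complexify A) i j = flat A i j.
Proof.
by apply/setP => k; rewrite !inE /vertex cross_map dot_map fmorph_eq0.
Qed.

Lemma flats_complexify : flats (complexify A) = flats A.
Proof. by apply: eq_imset => p; apply: flat_complexify. Qed.

Lemma complexify_arrangement : line_arrangement A -> line_arrangement (complexify A).
Proof.
move=> [A0 Ai]; split=> [i|i j]; first by rewrite /complexify map_mx_eq0.
by rewrite /complexify !map_submx => h; apply: Ai.
Qed.

End Complexify.

Theorem theoremA (R : realType) (d : nat) (A : 'I_d -> 'rV[R]_3)
    (hA : line_arrangement A)
    (hfree : free_real_arrangement A)
    (hmult : forall p : 'rV[R]_3, intersection_point A p ->
       multiplicity A p = 2 \/ multiplicity A p = 3 \/ multiplicity A p = 4) :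
  d <= 18.
Proof.
rewrite leqNgt; apply/negP => d19.
have d1 : 1 < d by apply: leq_trans d19.
have mE i j : multiplicity A (vertex A i j) = #|flat A i j| by [].
have h i j : i != j -> [|| #|flat A i j| == 2, #|flat A i j| == 3 | #|flat A i j| == 4].
  move=> ij; have [||[]] := hmult (vertex A i j); last 3 first.
  - by rewrite mE => ->.
  - by rewrite mE => ->.
  - by rewrite mE => ->.
  split; first exact: vertex_neq0.
  by rewrite mE; apply: card_flats; apply: mem_flats.
have h234 X : X \in flats A -> [|| #|X| == 2, #|X| == 3 | #|X| == 4].
  by move=> /flatP[i [j [ij ->]]]; apply: h.
have small i j : i != j -> #|flat A i j| <= 4.
  by move=> /h /or3P[]/eqP->.
have small_flats X : X \in flats A -> #|X| <= 4.
  by move=> /flatP[i [j [ij ->]]]; apply: small.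
have ess i j : i != j -> exists k, k \notin flat A i j.
  move=> ij; apply/existsP; rewrite -negb_forall; apply: contraL d19 => /forallP all.
  have <- : #|flat A i j| = d.
    by rewrite -[RHS]card_ord; apply: eq_card => k; rewrite all.
  by rewrite -leqNgt (leq_trans (small _ _ ij)).
have [k ek gap] := @binomial_gap d.-1 ltac:(by rewrite -subn1 ltn_subRL (leq_trans _ d19)).
have dC : (d%:R != 0 :> R[i])%R by rewrite pnatr_eq0 -lt0n (ltn_trans _ d1).
have := saturated_count (complexify_arrangement hA) dC hfree d1 ek.
rewrite flats_complexify => cnt.
(* [saturated_count] asks for [2 * #|X| <= k], and flats have at most 4 lines. *)
have k8 : 8 <= k by move: ek d19; clear; lia.
have {}cnt := gap _ (cnt (fun X XF => leq_trans (leq_mul (leqnn 2) (small_flats X XF)) k8)).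
have mel := melchior hA d1 ess.
have meq := melchior_equality hA d1 ess.
have pairs := sum_pairs_flats hA.
rewrite (sum_flats h234 (fun n => n * (n - 1))) in pairs.
rewrite (sum_flats h234 (fun n => (n - 1) ^ 2)) in cnt.
have s0 := sum_flats h234 id.
have s1 := sum_flats h234 (subn^~ 1).
rewrite s0 s1 in mel meq.
have d5 : 4 < d.-1 by move: d19; clear; lia.
have {}meq := meq (fun i j ij => leq_ltn_trans (small i j ij) d5).
rewrite -/(num_flats A 2) in meq.
move: d19 pairs cnt mel meq; rewrite /doubles -/(num_flats A 2).
move: (num_flats A 2) (num_flats A 3) (num_flats A 4) => t2 t3 t4 /=.
clear; case: d => // e; rewrite subn1 /=.
move=> d19 pairs cnt mel meq.
have e18 : e <= 18.
  (* Three times the count minus eight times the pair identity gives [e^2 - 8 e <= 12 t4 - 4 t2];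
     then [t2 >= 3 + t4] and [14 t4 <= e^2 + e - 6] finish. As [e >= 18], no subtraction is
     truncated. *)
  suff : (e - 2) * (e - 18) <= 0 by move: d19; clear; nia.
  by move: d19 pairs cnt mel; clear; nia.
have {d19}e18' : e = 18 by move: e18 d19; clear; lia.
(* All bounds are now tight, so the premise of [meq] holds and its conclusion reads [216 <= 200]. *)
by move: pairs cnt mel meq; rewrite e18'; clear; lia.
Qed.
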